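(* Let $\mu$ be a probability measure on $X$, let $\alpha$ be a Young function and let $c>0$. The following are equivalent: (i) $\mu$ satisfies $\mathbf{T}_\alpha(1/c)$; (ii) there exist constants $a,b>0$ such that for every integer $n\ge1$ and every bounded continuous function $f:X^n\to\mathbb{R}^+$, $$\int e^{c\,Q_{\alpha,n}f}\,d\mu^n\le a\,e^{b\,\mu^n(f)},$$ where $Q_{\alpha,n}f(x)=\inf_{y\in X^n}\left\{f(y)+\sum_{i=1}^n\alpha(d(x_i,y_i))\right\}$ for $x=(x_1,\dots,x_n)\in X^n$.
   Context: Throughout, $(X,d)$ is a complete separable metric space whose closed balls are compact; measures are Borel. $\mu^n$ is the $n$-fold product measure on $X^n$, and $\mu^n(f)=\int f\,d\mu^n$. A Young function is an even convex function $\alpha:\mathbb{R}\to\mathbb{R}^+$ (finite valued), increasing on $\mathbb{R}^+$, with $\alpha(0)=0$ and $\alpha'(0)=0$. Optimal transport cost: $\mathcal{T}_\alpha(\nu,\mu)=\inf_\pi\iint\alpha(d(x,y))\,d\pi(x,y)$, the infimum being over all probability measures $\pi$ on $X\times X$ with marginals $\nu$ and $\mu$. Relative entropy: $H(\nu|\mu)=\int\log\frac{d\nu}{d\mu}\,d\nu$ if $\nu\ll\mu$, and $+\infty$ otherwise. $\mu$ satisfies $\mathbf{T}_\alpha(C)$ if $\mathcal{T}_\alpha(\nu,\mu)\le C\,H(\nu|\mu)$ for all probability measures $\nu$ on $X$. *)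

(* Defs.v *)
From HB Require Import structures.
From mathcomp Require Import all_boot all_order all_algebra.
From mathcomp Require Import all_classical all_reals all_analysis.
Set Implicit Arguments.
Unset Strict Implicit.
Unset Printing Implicit Defensive.
Import Order.TTheory GRing.Theory Num.Theory.
Import numFieldNormedType.Exports.
Local Open Scope classical_set_scope.
Local Open Scope ring_scope.

(* Nothing here relates the sigma-algebra to the topology: that it is the Borel
   one is the separate hypothesis [borel_measurable].  The base point comes from
   [measurableType] and is harmless, as a space carrying a probability measure
   is nonempty. *)
#[short(type="completeMetricMeasurableType")]
HB.structure Definition CompleteMetricMeasurable (d : measure_display)
    (R : numDomainType) :=
  { T of Complete T & Metric R T & Measurable d T }.

Section space.
Context {d : measure_display} {R : realType}.
Variable X : completeMetricMeasurableType d R.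

Definition borel_measurable := @measurable d X = <<s @open X >>.

Definition separable := exists2 S : set X, countable S & dense S.

Definition compact_closed_balls :=
  forall (x : X) (r : R), compact [set y : X | mdist x y <= r].

End space.

(* "Increasing" is taken in the wide sense; it then follows from the other
   clauses, and functions vanishing near 0 are allowed. *)
Record young_function (R : realType) (alpha : R -> R) : Prop := YoungFunction {
  young_ge0 : forall t, 0 <= alpha t ;
  young_even : forall t, alpha (- t) = alpha t ;
  young_convex : convex_function [set: R] (alpha : R -> R^o) ;
  young_increasing : forall s t : R, 0 <= s -> s <= t -> alpha s <= alpha t ;
  young0 : alpha 0 = 0 ;
  young_derive0 : is_derive (0 : R) (1 : R) alpha 0
}.

Section product_power.
Context {d : measure_display} {T : measurableType d} {R : realType}.

Definition tcons (n : nat) (z : T * n.-tuple T) : n.+1.-tuple T :=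
  [tuple of z.1 :: z.2].

Lemma measurable_tcons (n : nat) : measurable_fun setT (@tcons n).
Proof. exact: measurable_cons measurable_fst measurable_snd. Qed.

HB.instance Definition _ (n : nat) :=
  isMeasurableFun.Build _ _ _ _ (@tcons n) (@measurable_tcons n).

Variable mu : probability T R.

Fixpoint power_prob (n : nat) : probability (n.-tuple T) R :=
  match n with
  | 0 => dirac [tuple]
  | n'.+1 => distribution (mu \x power_prob n')%E (@tcons n')
  end.

Lemma power_prob_rect (n : nat) (A : 'I_n -> set T) :
  (forall i, measurable (A i)) ->
  power_prob n [set x | forall i, A i (tnth x i)] = (\prod_(i < n) mu (A i))%E.
Proof.
elim: n A => [|n IH] A mA.
  by rewrite big_ord0 /= diracE mem_set// => -[].
pose B := [set x : n.-tuple T | forall i, A (lift ord0 i) (tnth x i)].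
have mB : measurable B.
  have -> : B = \bigcap_(i in [set: 'I_n])
      ((fun x : n.-tuple T => tnth x i) @^-1` A (lift ord0 i)).
    by apply/seteqP; split => x /= h i; [move=> _; exact: h|exact: h].
  apply: fin_bigcap_measurable => [|i _]; first exact: finite_finset.
  by rewrite -[X in measurable X]setTI; exact: measurable_tnth.
have AB : @tcons n @^-1` [set x | forall i, A i (tnth x i)] = A ord0 `*` B.
  apply/seteqP; split => -[x t] /=.
    move=> h; split; first exact: (h ord0).
    by move=> i; have := h (lift ord0 i); rewrite tnthS.
  move=> [h0 hS] i; have [j ->|->//] := unliftP ord0 i.
  by rewrite tnthS; exact: hS.
rewrite big_ord_recl /= /distribution /pushforward AB.
rewrite product_measure1E//; congr (_ * _)%E.
by apply: (IH (fun i => A (lift ord0 i))) => i; exact: mA.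
Qed.

End product_power.

Section relative_entropy.
Local Open Scope ereal_scope.
Context {d : measure_display} {T : measurableType d} {R : realType}.

(* The library's density is an integrable function that may be negative on a
   nu-negligible set, where [lne] is -oo; this does not affect the integral. *)
Definition relative_entropy (nu mu : probability T R) : \bar R :=
  if `[< nu `<< mu >]
  then \int[nu]_x lne (Radon_Nikodym (charge_of_finite_measure nu) mu x)
  else +oo.

End relative_entropy.

Section transport.
Local Open Scope ereal_scope.
Context {d : measure_display} {R : realType}.
Variables (X : completeMetricMeasurableType d R) (alpha : R -> R).

Definition coupling (nu mu : probability X R) : set (probability (X * X)%type R) :=
  [set pi | forall A : set X, measurable A ->
     pi (fst @^-1` A) = nu A /\ pi (snd @^-1` A) = mu A].

Definition transport_cost (nu mu : probability X R) : \bar R :=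
  ereal_inf [set \int[pi]_z (alpha (mdist z.1 z.2))%:E
            | pi in coupling nu mu].

Definition transport_inequality (C : R) (mu : probability X R) : Prop :=
  forall nu : probability X R,
    transport_cost nu mu <= C%:E * relative_entropy nu mu.

End transport.

Section inf_convolution.
Context {d : measure_display} {R : realType}.
Variables (X : completeMetricMeasurableType d R) (n : nat).

(* Tuples carry no topology in the library; [{ptws 'I_n -> X}] is X^n with the
   product topology. *)
Definition tuple_continuous (f : n.-tuple X -> R) :=
  continuous (fun x : {ptws 'I_n -> X} => f [tuple x i | i < n]).

Definition inf_convolution (alpha : R -> R) (f : n.-tuple X -> R)
    (x : n.-tuple X) : R :=
  inf [set f y + \sum_(i < n) alpha (mdist (tnth x i) (tnth y i))
      | y in [set: n.-tuple X]].

End inf_convolution.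

(* Main.v *)
Require Import Defs.
From HB Require Import structures.
From mathcomp Require Import all_boot all_order all_algebra.
From mathcomp Require Import all_classical all_reals all_analysis.
From mathcomp Require Import measurable_realfun finmap ring lra.
Import Order.TTheory GRing.Theory Num.Theory.
Import numFieldNormedType.Exports.
Local Open Scope classical_set_scope.
Local Open Scope ring_scope.
Set Implicit Arguments.
Unset Strict Implicit.
Unset Printing Implicit Defensive.

(** (i) => (ii) holds with a = 1 and b = c.  Testing the transport inequality on
    nu = e^{c Qf} mu / Z, for which H(nu|mu) = c nu(Qf) - log Z, against the easy
    half of duality nu(Qf) - mu(f) <= T(nu,mu) gives mu(e^{c Qf}) <= e^{c mu(f)}
    for bounded measurable f >= 0.  This tensorizes by induction on n because
    Q_{n+1} f is obtained by infimal convolution in one variable at a time.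

    (ii) => (i).  Applied to the positive part of sum_i (phi(x_i) - m) with
    m > mu(phi), whose mean is bounded uniformly in n, (ii) bounds the n-th power
    of mu(e^{c (Q phi - m)}) independently of n; hence
    mu(e^{c Q phi}) <= e^{c mu(phi)} for phi >= 0 continuous, and then for
    phi measurable since Q phi is a uniform limit of Q phi_k with phi_k <= phi
    Lipschitz.  Gibbs' inequality turns this into
    nu(Q phi) - mu(phi) <= H(nu|mu) / c, and the hard half of Kantorovich duality
    concludes: Hahn-Banach gives a finitely additive coupling of nu and mu with
    cost at most H(nu|mu) / c, which is countably additive on rectangles because
    nu and mu are regular with respect to compact sets. *)

(** * Hahn-Banach for functionals dominated on a subspace *)

(** The second half is shaped by finite additivity. The Hahn-Banach functional lives on all bounded
    functions of two variables, and its values on indicators of measurable cylinders must be the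
    marginals; the dual inequality is therefore needed for measurable test functions, although (ii)
    speaks only of continuous ones. The cost may be unbounded, so it lies outside this space: it
    enters through the dominating functional, where each unit of it is charged K = H(nu|mu) / c, and
    is approached from below by staircases built on its superlevel sets. These sets are open, hence
    countable unions of measurable rectangles, and on such unions a measure that agrees with the
    functional on rectangles can only be smaller. Both losses thus go in the favourable
    direction. *)

Record sublinear_on {R : realType} {V : lmodType R} (D : set V) (p : V -> R) :
    Prop := SublinearOn {
  sublinearD : forall u v, D u -> D v -> p (u + v) <= p u + p v ;
  sublinearZ : forall t u, 0 <= t -> D u -> p (t *: u) = t * p u }.

Section hahn_banach.
Context {R : realType} {V : lmodType R}.
Variable D : set V.
Hypothesis D0 : D 0.
Hypothesis DD : forall u v, D u -> D v -> D (u + v).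
Hypothesis DZ : forall (t : R) u, D u -> D (t *: u).

Local Notation sublinear := (sublinear_on D).

Lemma sublinear_on0 p : sublinear p -> p 0 = 0.
Proof. by move=> sp; rewrite -(scale0r (0 : V)) (sublinearZ sp)// mul0r. Qed.

(** One-sided estimates on the sets [S u] suffice: the missing half of homogeneity is the proved
    half at [t^-1] and [t *: u]. Lower bounds of chains, the shift and the dual value are all infima
    of this kind. *)
Lemma sublinear_on_inf (S : V -> set R) :
  (forall u, D u -> has_inf (S u)) -> inf (S 0) = 0 ->
  (forall u v a b, D u -> D v -> S u a -> S v b ->
     exists2 c, S (u + v) c & c <= a + b) ->
  (forall t u a, 0 < t -> D u -> S u a ->
     exists2 c, S (t *: u) c & c <= t * a) ->
  sublinear (fun u => inf (S u)).
Proof.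
move=> iS S0 SD SZ; have lb u a : D u -> S u a -> inf (S u) <= a.
  by move=> /iS[_ Su] Sa; exact: ge_inf.
have qZ t u : 0 < t -> D u -> inf (S (t *: u)) <= t * inf (S u).
  move=> t0 Du; apply/ler_addgt0Pr => e e0.
  have [a Sa ae] := inf_adherent (divr_gt0 e0 t0) (iS _ Du).
  have [c Sc ca] := SZ _ _ _ t0 Du Sa.
  apply: le_trans (lb _ _ (DZ _ Du) Sc) (le_trans ca _).
  have -> : t * inf (S u) + e = t * (inf (S u) + e / t).
    by rewrite mulrDr mulrCA divff ?mulr1// gt_eqF.
  by rewrite ler_pM2l// ltW.
split => [u v Du Dv|t u].
  apply/ler_addgt0Pr => e e0; have e20 : 0 < e / 2 by lra.
  have [a Sa ae] := inf_adherent e20 (iS _ Du).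
  have [b Sb be] := inf_adherent e20 (iS _ Dv).
  have [c /(lb _ _ (DD Du Dv)) cS cab] := SD _ _ _ _ Du Dv Sa Sb; lra.
rewrite le_eqVlt => /predU1P[<-|t0] Du; first by rewrite scale0r mul0r.
apply/eqP; rewrite eq_le qZ//=.
have := qZ t^-1 (t *: u); rewrite invr_gt0 => /(_ t0 (DZ _ Du)).
rewrite scalerA mulVf ?gt_eqF// scale1r.
by rewrite -(ler_pM2l t0) mulrA mulfV ?gt_eqF// mul1r.
Qed.

Lemma sublinear_on_oppr p u : sublinear p -> D u -> - p (- u) <= p u.
Proof.
move=> sp Du; have DN : D (- u) by rewrite -scaleN1r; exact: DZ.
by have := sublinearD sp Du DN; rewrite subrr (sublinear_on0 sp); lra.
Qed.

Let below (p q : V -> R) := forall u, D u -> q u <= p u.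

(** The pointwise infimum is finite because [p u] is at least [- p (- u)], hence at least
    [- p0 (- u)]. It is subadditive because two members of a chain are comparable: the smaller one
    serves at both points. *)
Lemma sublinear_on_chain_inf (C : set (V -> R)) p0 :
  C p0 -> (forall p, C p -> sublinear p /\ below p0 p) ->
  (forall p q, C p -> C q -> below p q \/ below q p) ->
  exists2 q, sublinear q & forall p, C p -> below p q.
Proof.
move=> Cp0 Cs Ct; pose S u := [set p u | p in C].
have iS u : D u -> has_inf (S u).
  move=> Du; split; first by exists (p0 u), p0.
  exists (- p0 (- u)) => _ [p Cp <-]; have [sp p0p] := Cs _ Cp.
  apply: le_trans (sublinear_on_oppr sp Du); rewrite lerN2; apply: p0p.
  by rewrite -scaleN1r; exact: DZ.
have qlb u p : D u -> C p -> inf (S u) <= p u.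
  by move=> Du Cp; apply: ge_inf; [case: (iS _ Du)|exists p].
exists (fun u => inf (S u)); last by move=> p Cp u Du; exact: qlb.
apply: sublinear_on_inf => //.
- have -> : S 0 = [set 0]; last exact: inf1.
  apply/seteqP; split => [_ [p Cp <-]|_ ->] /=.
    exact: sublinear_on0 (Cs _ Cp).1.
  by exists p0 => //; exact: sublinear_on0 (Cs _ Cp0).1.
- move=> u v _ _ Du Dv [p1 C1 <-] [p2 C2 <-].
  have [p [Cp b1 b2]] : exists p, [/\ C p, p u <= p1 u & p v <= p2 v].
    by have [b|b] := Ct _ _ C1 C2; [exists p2|exists p1]; split => //; exact: b.
  exists (p (u + v)); first by exists p.
  by have := sublinearD (Cs _ Cp).1 Du Dv; lra.
- move=> t u _ t0 Du [p Cp <-]; exists (p (t *: u)); first by exists p.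
  by rewrite (sublinearZ (Cs _ Cp).1 (ltW t0) Du).
Qed.

(* With [q u = inf_{t >= 0} p (u + t v) - t p v]; hence a minimal sublinear
   functional is odd, and therefore additive. *)
Lemma sublinear_on_shift p v : sublinear p -> D v ->
  exists q, [/\ sublinear q, below p q & q (- v) <= - p v].
Proof.
move=> sp Dv; pose S u := [set p (u + t *: v) - t * p v | t in [set t | 0 <= t]].
have iS u : D u -> has_inf (S u).
  move=> Du; split; first by exists (p (u + 0 *: v) - 0 * p v), 0 => /=.
  exists (- p (- u)) => _ [t /= t0 <-].
  have DN : D (- u) by rewrite -scaleN1r; exact: DZ.
  have := sublinearD sp (DD Du (DZ t Dv)) DN.
  by rewrite addrAC subrr add0r (sublinearZ sp t0 Dv); lra.
have qlb u t : D u -> 0 <= t -> inf (S u) <= p (u + t *: v) - t * p v.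
  by move=> Du t0; apply: ge_inf; [case: (iS _ Du)|exists t].
have DNv : D (- v) by rewrite -scaleN1r; exact: DZ.
exists (fun u => inf (S u)); split.
- apply: sublinear_on_inf => //.
  + have -> : S 0 = [set 0]; last exact: inf1.
    apply/seteqP; split => [_ [t /= t0 <-]|_ ->] /=.
      by rewrite add0r (sublinearZ sp t0 Dv) subrr.
    by exists 0 => //=; rewrite scale0r addr0 mul0r subr0 (sublinear_on0 sp).
  + move=> u w _ _ Du Dw [t1 /= t10 <-] [t2 /= t20 <-].
    exists (p (u + w + (t1 + t2) *: v) - (t1 + t2) * p v).
      by exists (t1 + t2) => //=; exact: addr_ge0.
    have := sublinearD sp (DD Du (DZ t1 Dv)) (DD Dw (DZ t2 Dv)).
    by rewrite addrACA -scalerDl; lra.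
  + move=> t u _ t0 Du [s /= s0 <-].
    exists (p (t *: u + (t * s) *: v) - t * s * p v).
      by exists (t * s) => //=; rewrite mulr_ge0// ltW.
    rewrite -scalerA -scalerDr (sublinearZ sp (ltW t0)); last exact/DD/DZ.
    by rewrite -mulrA -mulrBr.
- move=> u Du; have := qlb u 0 Du (lexx _).
  by rewrite scale0r addr0 mul0r subr0.
- have := qlb (- v) 1 DNv ler01.
  by rewrite scale1r addNr (sublinear_on0 sp) mul1r sub0r.
Qed.

Theorem hahn_banach_dominated p : sublinear p ->
  exists L : V -> R, [/\ forall u v, D u -> D v -> L (u + v) = L u + L v,
    forall t u, D u -> L (t *: u) = t * L u & forall u, D u -> L u <= p u].
Proof.
move=> sp; pose T := {q : V -> R | sublinear q /\ below p q}.
(* [Rel q r] says that r lies below q on [D], so Zorn's lemma yields a minimal functional. *)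
pose Rel (q r : T) := `[< below (sval q) (sval r) >].
have t0 : T by exists p; split.
have [| |C Ctot|[q [sq pq]] qmax] := @ZL_preorder T t0 Rel.
- by move=> q; apply/asboolP => u.
- move=> q r s /asboolP h1 /asboolP h2; apply/asboolP => u Du.
  exact: le_trans (h2 _ Du) (h1 _ Du).
- have [[c Cc]|] := pselect (C !=set0); last first.
    by move=> C0; exists t0 => s Cs; exfalso; apply: C0; exists s.
  (* Adjoining [p] gives the chain the largest member that the previous lemma asks for. *)
  pose C' := p |` [set sval q | q in C].
  have [| |r sr rb] := @sublinear_on_chain_inf C' p (or_introl erefl).
  + by move=> _ [->|[q Cq <-]]; [split|exact: (svalP q)].
  + move=> _ _ [->|[q Cq <-]] [->|[r Cr <-]].
    * by left.
    * by left; exact: (svalP r).2.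
    * by right; exact: (svalP q).2.
    * by have [/asboolP|/asboolP] := Ctot _ _ Cq Cr; [left|right].
  have pr : below p r by apply: rb; left.
  exists (exist _ r (conj sr pr)) => s Cs; apply/asboolP; apply: rb.
  by right; exists s.
have qN v : D v -> q (- v) = - q v.
  move=> Dv; have [r [sr qr rv]] := sublinear_on_shift sq Dv.
  have pr : below p r by move=> u Du; exact: le_trans (qr _ Du) (pq _ Du).
  have /(_ _)/asboolP := qmax (exist _ r (conj sr pr)).
  rewrite /Rel/= => /(_ (asboolT qr)) rq.
  have DNv : D (- v) by rewrite -scaleN1r; exact: DZ.
  have := rq _ DNv; have := sublinear_on_oppr sq Dv; lra.
exists q; split => // [u v Du Dv|t u Du].
  have DNv : D (- v) by rewrite -scaleN1r; exact: DZ.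
  have := sublinearD sq Du Dv; have := sublinearD sq (DD Du Dv) DNv.
  by rewrite addrK qN//; lra.
have [t_ge0|/ltW tle0] := leP 0 t; first exact: (sublinearZ sq).
rewrite -[t]opprK scaleNr qN; last exact: DZ.
by rewrite (sublinearZ sq) ?oppr_ge0// !mulNr.
Qed.

End hahn_banach.

(** * Regularity of Borel probabilities on proper metric spaces *)

Section metric_measurability.
Context {d : measure_display} {R : realType}.
Variable X : completeMetricMeasurableType d R.

Lemma mdist_openP (U : set X) :
  (forall x, U x -> exists2 e : R, 0 < e & forall y, mdist x y < e -> U y) ->
  open U.
Proof.
move=> h; rewrite openE => x /h[e e0 eU]; apply/nbhs_ballP; exists e => //= y.
by rewrite ballEmdist; exact: eU.
Qed.

Lemma open_mdist (U : set X) x : open U -> U x ->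
  exists2 e : R, 0 < e & forall y, mdist x y < e -> U y.
Proof.
rewrite openE => oU /oU/nbhs_ballP[e /= e0 eU]; exists e => // y xy.
by apply: eU; rewrite ballEmdist.
Qed.

Lemma open_mdist_ball (x : X) (e : R) : open [set y | mdist x y < e].
Proof.
apply: mdist_openP => y /= xy; exists (e - mdist x y); first by rewrite subr_gt0.
by move=> z yz; have := metric_triangle x y z; lra.
Qed.

Lemma open_thickening (A : set X) (e : R) :
  open [set y | exists2 x, A x & mdist x y < e].
Proof.
rewrite (_ : mkset _ = \bigcup_(x in A) [set y | mdist x y < e])//.
by apply: bigcup_open => x _; exact: open_mdist_ball.
Qed.

Hypothesis X_borel : borel_measurable X.

Lemma open_borel (U : set X) : open U -> measurable U.
Proof. by move=> oU; rewrite X_borel; exact: sub_sigma_algebra. Qed.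

Variable nu : probability X R.

Lemma decreasing_small (F : (set X)^nat) (e : R) : 0 < e ->
  (forall n, measurable (F n)) -> {homo F : n m / (n <= m)%N >-> (m <= n)%O} ->
  \bigcap_n F n = set0 -> exists n, (nu (F n) < e%:E)%E.
Proof.
move=> e0 mF dF F0; have := @nonincreasing_cvg_mu _ _ _ nu F.
have F0oo : (nu (F 0%N) < +oo)%E by rewrite ltey_eq fin_num_measure.
rewrite F0 measure0 => /(_ F0oo mF measurable0 dF).
move=> /fine_cvgP[_] /cvgrPdist_lt/(_ e e0)[n _ /(_ n (leqnn n))]/=.
rewrite sub0r normrN ger0_norm ?fine_ge0// => h; exists n.
by rewrite -(@fineK _ (nu (F n))) ?fin_num_measure// lte_fin.
Qed.

(** Outer regularity of A and of its complement at once; the symmetry reduces stability under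
    complements to exchanging U and V. *)
Let squeezed (A : set X) := forall e : R, 0 < e -> exists U V : set X,
  [/\ open U, open V, A `<=` U, ~` A `<=` V & (nu (U `&` V) < e%:E)%E].

Let open_squeezed (A : set X) : open A -> squeezed A.
Proof.
move=> oA e e0.
(* Neighbourhoods of the complement of [A] shrink to it, as it is closed, so their traces on [A]
   shrink to the empty set. *)
pose V n := [set y | exists2 x, (~` A) x & mdist x y < n.+1%:R^-1 :> R].
have [n ne] : exists n, (nu (A `&` V n) < e%:E)%E.
  apply: decreasing_small => //.
  - by move=> n; apply: open_borel; apply: openI => //; exact: open_thickening.
  - move=> n m nm; apply/subsetPset; apply: setIS => y [x Ax xy]; exists x => //.
    by apply: lt_le_trans xy _; rewrite lef_pV2 ?posrE// ler_nat.
  - rewrite -subset0 => y yF; have [Ay _] := yF 0%N I.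
    have [r r0 rA] := open_mdist oA Ay.
    have [_ [x nAx xy]] := yF (Num.truncn r^-1) I; apply: nAx; apply: rA.
    rewrite metric_sym (lt_le_trans xy)// invf_ple ?posrE//.
    by rewrite ltW// truncnS_gt.
exists A, (V n); split => //; first exact: open_thickening.
by move=> y nAy; exists y => //; rewrite mdistxx.
Qed.

(** The intersection of all [V k] need not be open, so only the first n are kept. What escapes them
    lies in [W n], the part of the union missed by the first n sets [U k], whose measure tends to 0;
    the other half of e is spread geometrically over k. *)
Let bigcup_squeezed (A : (set X)^nat) :
  (forall n, squeezed (A n)) -> squeezed (\bigcup_n A n).
Proof.
move=> sA e e0; have e20 : 0 < e / 2 by lra.
have ek k : 0 < e / 2 / (2 ^ k.+1)%:R by rewrite divr_gt0// ltr0n expn_gt0.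
have [U /= UP] := choice (fun k => sA k _ (ek k)).
have {UP}[V UV] := choice UP.
have mU k : measurable (U k) by apply: open_borel; case: (UV k).
have mV k : measurable (V k) by apply: open_borel; case: (UV k).
pose W n := \bigcup_k U k `\` \big[setU/set0]_(k < n) U k.
have [n ne] : exists n, (nu (W n) < (e / 2)%:E)%E.
  apply: decreasing_small => //.
  - by move=> n; apply: measurableD; [exact: bigcupT_measurable|
      exact: bigsetU_measurable].
  - move=> n m nm; apply/subsetPset; apply: setDS.
    move=> y; rewrite -!bigcup_mkord => -[k /= kn Uky]; exists k => //=.
    exact: leq_trans kn nm.
  - rewrite -subset0 => y yW; have [[k _ Uky] _] := yW 0%N I.
    have [_] := yW k.+1 I; apply; rewrite -bigcup_mkord.
    by exists k => //=.
exists (\bigcup_k U k), (\big[setI/setT]_(k < n) V k); split.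
- by apply: bigcup_open => k _; case: (UV k).
- by apply: big_ind => //; [exact: openT|exact: openI|move=> k _; case: (UV k)].
- by apply: subset_bigcup => k _; case: (UV k).
- rewrite setC_bigcup -bigcap_mkord => y Ay k /= kn.
  by case: (UV k) => _ _ _ + _; apply; exact: Ay.
- apply: (@le_lt_trans _ _ (nu (W n `|` \big[setU/set0]_(k < n) (U k `&` V k)))).
    apply: le_measure; do ?apply: mem_set.
    + apply: measurableI; first exact: bigcupT_measurable.
      by apply: big_ind => //; exact: measurableI.
    + apply: measurableU; last by apply: bigsetU_measurable => k _;
        exact: measurableI.
      by apply: measurableD; [exact: bigcupT_measurable|exact: bigsetU_measurable].
    + move=> y [[k _ Uky]]; rewrite -bigcap_mkord => Vy.
      have [[j /= jn Ujy]|Wy] := pselect (exists2 j, (j < n)%N & U j y).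
        right; rewrite -(bigcup_mkord n (fun k => U k `&` V k)).
        by exists j => //; split => //; exact: Vy.
      left; split; first by exists k.
      by rewrite -bigcup_mkord => -[j /= jn Ujy]; apply: Wy; exists j.
  apply: (@le_lt_trans _ _ (nu (W n) + \sum_(k < n) nu (U k `&` V k))%E).
    apply: (le_trans (measureU2 _ _ _)).
    + by apply: measurableD; [exact: bigcupT_measurable|exact: bigsetU_measurable].
    + by apply: bigsetU_measurable => k _; exact: measurableI.
    + apply: leeD => //.
      apply: (@Boole_inequality _ _ _ nu (fun k => U k `&` V k)) => k _.
      exact: measurableI.
  rewrite (splitr e) EFinD; apply: lte_leD => //.
    by apply/sum_fin_numP => k _ _; rewrite fin_num_measure//; exact: measurableI.
  apply: le_trans (epsilon_trick0 xpredT (ltW e20)).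
  rewrite (le_trans _ (@nneseries_lim_ge _ _ xpredT _ n _))//; last first.
    by move=> k _ _; rewrite lee_fin ltW.
  rewrite big_mkord; apply: lee_sum => k _; apply/ltW.
  by case: (UV k).
Qed.

Lemma measurable_squeezed (A : set X) (e : R) : measurable A -> 0 < e ->
  exists U V : set X,
  [/\ open U, open V, A `<=` U, ~` A `<=` V & (nu (U `&` V) < e%:E)%E].
Proof.
rewrite X_borel => mA; move: e; change (squeezed A).
have : <<s @open X >> `<=` squeezed; last exact.
apply: smallest_sub => [|U]; last exact: open_squeezed.
split; [exact/open_squeezed/open0| |exact: bigcup_squeezed].
move=> B sB e e0; have [U [V [oU oV BU BV UV]]] := sB _ e0.
by exists V, U; rewrite setTD setCK setIC; split.
Qed.

Hypothesis X_proper : compact_closed_balls X.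

Lemma closed_mdist_ball (x : X) (e : R) : closed [set y | mdist x y <= e].
Proof.
rewrite -openC; apply: mdist_openP => y /= /negP; rewrite -ltNge => xy.
exists (mdist x y - e); first by rewrite subr_gt0.
move=> z yz; apply/negP; rewrite -ltNge.
have := metric_triangle x z y; rewrite (metric_sym z y); lra.
Qed.

Lemma compact_borel (K : set X) : compact K -> measurable K.
Proof.
move=> cK; rewrite -[K]setCK; apply: measurableC; apply: open_borel.
by rewrite openC; apply: compact_closed => //; exact: metric_hausdorff.
Qed.

Lemma measurable_compact_open (A : set X) (e : R) : measurable A -> 0 < e ->
  exists K U : set X, [/\ compact K, open U, K `<=` A, A `<=` U &
    (nu (A `\` K) < e%:E)%E /\ (nu (U `\` A) < e%:E)%E].
Proof.
move=> mA e0; have e20 : 0 < e / 2 by lra.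
have [U [V [oU oV AU AV UV]]] := measurable_squeezed mA e20.
pose B n := [set y : X | mdist point y <= n%:R :> R].
have mB n : measurable (~` B n).
  by apply: open_borel; rewrite openC; exact: closed_mdist_ball.
have [n ne] : exists n, (nu (~` B n) < (e / 2)%:E)%E.
  apply: decreasing_small => //.
  - move=> n m nm; apply/subsetPset; apply: subsetC => y; rewrite /B/=.
    by move=> /le_trans; apply; rewrite ler_nat.
  - rewrite -subset0 => y /(_ (Num.truncn (mdist (point : X) y)).+1 I); apply.
    by rewrite /B/= ltW// truncnS_gt.
have mU := open_borel oU; have mV := open_borel oV.
(* A closed ball minus V is compact, and it lies in A because V covers the complement of A. *)
exists (B n `&` ~` V), U; split => //.
- by apply: compact_closedI; [exact: X_proper|exact: open_closedC].
- by move=> y [_]; apply: contra_notP => nAy; exact: AV.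
- split.
    rewrite (splitr e) EFinD.
    apply: (@le_lt_trans _ _ (nu (~` B n) + nu (U `&` V))%E); last exact: lteD.
    apply: le_trans (measureU2 _ (mB n) (measurableI _ _ mU mV)).
    apply: le_measure; do ?apply: mem_set.
    + apply: measurableD => //; apply: measurableI; last exact: measurableC.
      by rewrite -[B n]setCK; exact: measurableC.
    + by apply: measurableU => //; exact: measurableI.
    + move=> y [Ay nBV]; have [By|] := pselect (B n y); last by left.
      right; split; first exact: AU.
      by apply: contrapT => nVy; apply: nBV.
  apply: (@lt_trans _ _ (e / 2)%:E); last by rewrite lte_fin; lra.
  apply: le_lt_trans UV; apply: le_measure; do ?apply: mem_set; [exact: measurableD|
    exact: measurableI|].
  by move=> y [Uy /AV Vy].
Qed.

End metric_measurability.

(** * From finitely additive couplings to couplings *)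

Section rectangles.
Context {d1 d2 : measure_display}.
Variables (T1 : measurableType d1) (T2 : measurableType d2).

(** A copy of the product type, to carry the semiring of measurable rectangles while [T1 * T2] keeps
    its product sigma-algebra. The display that follows is opaque, which keeps the two structures
    apart. *)
Definition rect_type : Type := (T1 * T2)%type.

Definition rect_display : measure_display -> measure_display -> measure_display.
Proof. by move=> e _; exact: e. Qed.

Definition rect : set (set rect_type) :=
  [set A `*` B | A in measurable & B in measurable].

Let rect0 : rect set0.
Proof. by exists set0 => //; exists set0 => //; rewrite setX0. Qed.

Let rectI : setI_closed rect.
Proof.
move=> _ _ [A mA [B mB <-]] [C mC [D mD <-]]; rewrite -setXI.
by exists (A `&` C); [exact: measurableI|exists (B `&` D) => //; exact: measurableI].
Qed.

Let rectD : semi_setD_closed rect.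
Proof.
move=> _ _ [A mA [B mB <-]] [C mC [D mD <-]].
exists [set (A `\` C) `*` B; (A `&` C) `*` (B `\` D)]; split.
- exact: finite_set2.
- move=> _ [->|->].
    by exists (A `\` C); [exact: measurableD|exists B].
  exists (A `&` C); first exact: measurableI.
  by exists (B `\` D) => //; exact: measurableD.
- rewrite bigcup_setU !bigcup_set1; apply/seteqP; split => [[x y]|[x y]] /=.
    move=> [[Ax By]] /not_andP nCD.
    have [Cx|nCx] := pselect (C x); last by left.
    by right; split => //; split => //; case: nCD.
  by move=> [[[Ax nCx] By]|[[Ax Cx] [By nDy]]]; split => // -[].
- move=> I J /= [->|->] [->|->] [[x y] []]//=.
    by move=> [[_ nC] _] [[_ C'] _].
  by move=> [[_ C'] _] [[_ nC] _].
Qed.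

HB.instance Definition _ := Pointed.copy rect_type (T1 * T2)%type.
HB.instance Definition _ := @isSemiRingOfSets.Build (rect_display d1 d2)
  rect_type rect rect0 rectI rectD.

End rectangles.

HB.instance Definition _ (T U : ptopologicalType) := Pointed.on (T * U)%type.

Section finitely_additive_coupling.
Context {d : measure_display} {R : realType}.
Variable X : completeMetricMeasurableType d R.
Hypothesis X_borel : borel_measurable X.
Hypothesis X_proper : compact_closed_balls X.
Variables nu mu : probability X R.
Variable L : set (X * X) -> R.
Hypothesis L_ge0 : forall E, 0 <= L E.
Hypothesis L_additive : forall E F, E `&` F = set0 -> L (E `|` F) = L E + L F.
Hypothesis L_fst : forall A, measurable A -> (L (fst @^-1` A))%:E = nu A.
Hypothesis L_snd : forall A, measurable A -> (L (snd @^-1` A))%:E = mu A.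

Lemma additive_set0 : L set0 = 0.
Proof. by have := L_additive (setI0 set0); rewrite setU0; lra. Qed.

Lemma additive_le E F : E `<=` F -> L E <= L F.
Proof.
move=> EF; rewrite -(setDUK EF) L_additive ?lerDl//.
by rewrite setDIK.
Qed.

Lemma additive_setU E F : L (E `|` F) <= L E + L F.
Proof.
rewrite -(setDUK (@subsetUl _ E F)) L_additive ?setDIK// lerD2l.
by apply: additive_le => x [[]].
Qed.

Lemma additive_bigcup (s : seq nat) (E : nat -> set (X * X)) :
  L (\big[setU/set0]_(k <- s) E k) <= \sum_(k <- s) L (E k).
Proof.
elim: s => [|k s IH]; first by rewrite !big_nil additive_set0.
by rewrite !big_cons (le_trans (additive_setU _ _))// lerD2l.
Qed.

Lemma additive_bigcup_disjoint n (E : nat -> set (X * X)) : trivIset setT E ->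
  L (\big[setU/set0]_(k < n) E k) = \sum_(k < n) L (E k).
Proof.
move=> tE; elim: n => [|n IH]; first by rewrite !big_ord0 additive_set0.
rewrite !big_ord_recr/= L_additive ?IH// -subset0 -bigcup_mkord => x.
move=> [[k /= kn Ekx] Enx]; have := tE k n I I.
by move=> /(_ (ex_intro _ x (conj Ekx Enx))) ekn; rewrite ekn ltnn in kn.
Qed.

(** A point of the first rectangle outside the second has its first coordinate in A minus C or its
    second in B minus D, and the marginals measure these two events. This serves both to shrink a
    rectangle to a compact one and to enlarge the covering rectangles to open ones. *)
Lemma additive_rect_diff (A B C D : set X) :
  measurable A -> measurable B -> measurable C -> measurable D ->
  ((L (A `*` B))%:E <=
     (L (C `*` D))%:E + nu (A `\` C) + mu (B `\` D))%E.
Proof.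
move=> mA mB mC mD.
rewrite -L_fst; last exact: measurableD.
rewrite -L_snd; last exact: measurableD.
rewrite -!EFinD lee_fin.
apply: le_trans (lerD (additive_setU _ _) (lexx _)).
apply: le_trans (additive_setU _ _).
apply: additive_le => -[x y] [/= Ax By].
have [Cx|] := pselect (C x); last by left; right.
by have [Dy|] := pselect (D y); [left; left|right].
Qed.

Let content (E : set (rect_type X X)) : \bar R := (L E)%:E.

Let content_ge0 E : (0 <= content E)%E.
Proof. by rewrite lee_fin. Qed.

Let content_semi_additive : measure_function.semi_additive content.
Proof.
by move=> F n _ tF _; rewrite /content (additive_bigcup_disjoint _ tF) sumEFin.
Qed.

HB.instance Definition _ := isContent.Build _ _ _ content
  content_ge0 content_semi_additive.

(** Compactness makes up for countable additivity: the product of [K1] and [K2] is compact, the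
    covering rectangles are enlarged to open ones, and a finite subcover reduces the claim to finite
    subadditivity. Half of e pays for the compact sets and half for the open ones, a quarter for
    each marginal. *)
Let content_sigma_subadditive : measurable_subset_sigma_subadditive content.
Proof.
move=> E F mF [A mA [B mB <-]] ABF.
have h k : exists GH : set X * set X,
    [/\ measurable GH.1, measurable GH.2 & F k = GH.1 `*` GH.2].
  by case: (mF k) => C mC [D mD <-]; exists (C, D).
have {h}[GH mGH] := choice h; pose G k := (GH k).1; pose H k := (GH k).2.
apply/lee_addgt0Pr => e e0.
have e40 : 0 < e / 4 by lra.
have ek k : 0 < e / 4 / (2 ^ k.+1)%:R by rewrite divr_gt0// ltr0n expn_gt0.
have [K1 [_ [cK1 _ K1A _ [AK1 _]]]] :=
  measurable_compact_open X_borel nu X_proper mA e40.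
have [K2 [_ [cK2 _ K2B _ [BK2 _]]]] :=
  measurable_compact_open X_borel mu X_proper mB e40.
have hU k : exists U, [/\ open U, G k `<=` U &
    (nu (U `\` G k) < (e / 4 / (2 ^ k.+1)%:R)%:E)%E].
  have [mGk _ _] := mGH k.
  have [_ [U [_ oU _ GU [_ ?]]]] :=
    measurable_compact_open X_borel nu X_proper mGk (ek k).
  by exists U.
have hV k : exists U, [/\ open U, H k `<=` U &
    (mu (U `\` H k) < (e / 4 / (2 ^ k.+1)%:R)%:E)%E].
  have [_ mHk _] := mGH k.
  have [_ [U [_ oU _ HU [_ ?]]]] :=
    measurable_compact_open X_borel mu X_proper mHk (ek k).
  by exists U.
have {hU}[U hU] := choice hU; have {hV}[V hV] := choice hV.
have cK : compact (K1 `*` K2) by exact: compact_setX.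
have oUV k : [set: nat] k -> open (U k `*` V k).
  have [oU _ _] := hU k; have [oV _ _] := hV k.
  rewrite openE => _ -[x y] [/= Ux Vy].
  by exists (U k, V k) => //; split; exact: open_nbhs_nbhs.
have KUV : K1 `*` K2 `<=` cover [set: nat] (fun k => U k `*` V k).
  move=> [x y] [/= K1x K2y].
  have [|k _] := ABF (x, y); first by split; [exact: K1A|exact: K2B].
  have [_ _ ->] := mGH k; move=> [/= Gx Hy]; exists k => //; split => /=.
    by have [_ + _] := hU k; apply.
  by have [_ + _] := hV k; apply.
move: cK; rewrite (@compact_cover (X * X)%type) => /(_ _ _ _ oUV KUV)[S _ KS].
have mK1 := compact_borel X_borel cK1; have mK2 := compact_borel X_borel cK2.
apply: (le_trans (additive_rect_diff mA mB mK1 mK2)).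
apply: (@le_trans _ _ ((L (K1 `*` K2))%:E + (e / 4)%:E + (e / 4)%:E)%E).
  by apply: leeD; [apply: leeD => //; exact: ltW|exact: ltW].
have -> : e%:E = ((e / 2)%:E + (e / 4 + e / 4)%:E)%E.
  by rewrite -EFinD; congr EFin; lra.
rewrite -[leLHS]addeA [leRHS]addeA; apply: leeD; last by rewrite EFinD.
have mU k : measurable (U k) by apply: open_borel => //; case: (hU k).
have mV k : measurable (V k) by apply: open_borel => //; case: (hV k).
have LS : ((L (K1 `*` K2))%:E <= \sum_(k <- S) (content (F k) +
    (e / 2 / (2 ^ k.+1)%:R)%:E))%E.
  apply: (@le_trans _ _ (\sum_(k <- S) (L (U k `*` V k))%:E)%E).
    rewrite sumEFin lee_fin; apply: le_trans (additive_bigcup _ _).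
    by apply: additive_le; rewrite -bigcup_fset.
  apply: lee_sum => k _; have [mG mH FGH] := mGH k.
  apply: (le_trans (additive_rect_diff (mU k) (mV k) mG mH)).
  rewrite -addeA /content FGH; apply: leeD; first by [].
  have -> : e / 2 / (2 ^ k.+1)%:R =
      e / 4 / (2 ^ k.+1)%:R + e / 4 / (2 ^ k.+1)%:R :> R.
    by rewrite -mulrDl; congr (_ / _); lra.
  rewrite EFinD; apply: leeD; apply: ltW.
    by case: (hU k).
  by case: (hV k).
apply: (le_trans LS); apply: le_trans (epsilon_trick _ _ _).
- rewrite nneseries_esum; last first.
    by move=> k _; rewrite adde_ge0// lee_fin divr_ge0//; lra.
  apply: esum_ge; exists [set` S] => //.
  by rewrite fsbig_finite//= set_fsetK.
- by move=> n; exact: content_ge0.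
- lra.
Qed.

HB.instance Definition _ := Content_SigmaSubAdditive_isMeasure.Build _ _ _
  content content_sigma_subadditive.

Let pi (E : set (X * X)) : \bar R := measure_extension content E.

Let pi_rect (A B : set X) : measurable A -> measurable B ->
  pi (A `*` B) = (L (A `*` B))%:E.
Proof.
move=> mA mB; rewrite /pi /measure_extension measurable_mu_extE//.
by exists A => //; exists B.
Qed.

Let pi0 : pi set0 = 0%E.
Proof. exact: measure0. Qed.

Let pi_ge0 E : (0 <= pi E)%E.
Proof. exact: measure_ge0. Qed.

Let pi_semi_sigma_additive : semi_sigma_additive pi.
Proof.
move=> F mF tF mUF; apply: measure_semi_sigma_additive => //.
- by move=> i; have := mF i; rewrite measurable_prod_measurableType.
- by have := mUF; rewrite measurable_prod_measurableType.
Qed.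

HB.instance Definition _ := isMeasure.Build _ _ _ pi
  pi0 pi_ge0 pi_semi_sigma_additive.

Let pi_setT : pi setT = 1%E.
Proof.
rewrite -setXTT pi_rect// -(@probability_setT _ _ _ nu) -L_fst//.
by rewrite preimage_setT setXTT.
Qed.

HB.instance Definition _ := Measure_isProbability.Build _ _ _ pi pi_setT.

Lemma probability_of_additive : exists P : probability (X * X)%type R,
  forall A B, measurable A -> measurable B -> P (A `*` B) = (L (A `*` B))%:E.
Proof. by exists pi; exact: pi_rect. Qed.

End finitely_additive_coupling.

(** * Measurability through level sets, and integrals of bounded functions *)

Lemma measurable_fun_sublevel {d} {T : measurableType d} {R : realType}
    (g : T -> R) :
  (forall s : R, measurable [set x | g x < s]) -> measurable_fun setT g.
Proof.
move=> h; apply: (measurability _ (RGenInftyO.measurableE R)) => //.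
move=> _ [_ [s ->] <-]; rewrite setTI.
by rewrite (_ : _ @^-1` _ = [set z | g z < s]).
Qed.

Lemma measurable_fun_superlevel {d} {T : measurableType d} {R : realType}
    (g : T -> R) :
  (forall s : R, measurable [set x | s < g x]) -> measurable_fun setT g.
Proof.
move=> h; apply: (measurability _ (RGenOInfty.measurableE R)) => //.
move=> _ [_ [s ->] <-]; rewrite setTI (_ : _ @^-1` _ = [set z | s < g z])//.
by apply/seteqP; split => z /=; rewrite in_itv/= andbT.
Qed.

Definition bounded_measurable {d} {T : measurableType d} {R : realType}
    (f : T -> R) : Prop :=
  measurable_fun setT f /\ exists M, forall x, `|f x| <= M.

Section bounded_measurable.
Context {d : measure_display} {T : measurableType d} {R : realType}.
Implicit Types f g : T -> R.

Lemma bounded_measurable_cst (k : R) : bounded_measurable (fun _ : T => k).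
Proof. by split => //; exists `|k|. Qed.

Lemma bounded_measurableD f g : bounded_measurable f -> bounded_measurable g ->
  bounded_measurable (fun x => f x + g x).
Proof.
move=> [mf [M fM]] [mg [N gN]]; split; first exact: measurable_funD.
by exists (M + N) => x; rewrite (le_trans (ler_normD _ _))// lerD.
Qed.

Lemma bounded_measurableZ (k : R) f : bounded_measurable f ->
  bounded_measurable (fun x => k * f x).
Proof.
move=> [mf [M fM]]; split; first exact: measurable_funM.
by exists (`|k| * M) => x; rewrite normrM ler_wpM2l.
Qed.

Lemma bounded_measurable_indic (A : set T) : measurable A ->
  bounded_measurable (\1_A : T -> R).
Proof.
move=> mA; split; first exact: measurable_indic.
by exists 1 => x; rewrite indicE; case: (_ \in _); rewrite ?normr1 ?normr0.
Qed.

Variable P : probability T R.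

Lemma bounded_measurable_integrable f : bounded_measurable f ->
  P.-integrable setT (EFin \o f).
Proof.
move=> [mf [M fM]]; apply: measurable_bounded_integrable => //.
  by rewrite ltey_eq fin_num_measure.
by exists M; split; [exact: num_real|move=> N MN x _; exact: le_trans (fM x) (ltW MN)].
Qed.

Lemma integral_bounded f : bounded_measurable f ->
  (\int[P]_x (f x)%:E = (\int[P]_x f x)%R%:E)%E.
Proof.
move=> bf; rewrite /Rintegral fineK//.
by apply: integrable_fin_num => //; exact: bounded_measurable_integrable.
Qed.

Lemma bounded_RintegralD f g : bounded_measurable f -> bounded_measurable g ->
  \int[P]_x (f x + g x) = \int[P]_x f x + \int[P]_x g x.
Proof. by move=> bf bg; apply: RintegralD => //; exact: bounded_measurable_integrable. Qed.

Lemma bounded_RintegralZ (k : R) f : bounded_measurable f ->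
  \int[P]_x (k * f x) = k * \int[P]_x f x.
Proof. by move=> bf; apply: RintegralZl => //; exact: bounded_measurable_integrable. Qed.

Lemma probability_integral_cst (k : R) : (\int[P]_x k%:E = k%:E)%E.
Proof.
rewrite integral_cst//; transitivity (k%:E * 1)%E; last exact: mule1.
by congr (_ * _)%E; exact: probability_setT.
Qed.

Lemma probability_Rintegral_cst (k : R) : \int[P]_x k = k.
Proof.
by rewrite /Rintegral probability_integral_cst.
Qed.

Lemma bounded_le_Rintegral f g : bounded_measurable f -> bounded_measurable g ->
  (forall x, f x <= g x) -> \int[P]_x f x <= \int[P]_x g x.
Proof. by move=> bf bg fg; apply: le_Rintegral => //; exact: bounded_measurable_integrable. Qed.

Lemma probability_Rintegral_indic (A : set T) : measurable A ->
  (\int[P]_x (\1_A x : R))%:E = P A.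
Proof.
move=> mA; rewrite -integral_bounded; last exact: bounded_measurable_indic.
by rewrite integral_indic// setIT.
Qed.

End bounded_measurable.

(** * Comparison of a measure with a finitely additive function on unions of rectangles *)

Section additive_rectangles.
Context {d : measure_display} {R : realType} {X : measurableType d}.
Variables (P : probability (X * X)%type R) (L : set (X * X) -> R).
Hypothesis L_ge0 : forall E, 0 <= L E.
Hypothesis L_additive : forall E F, E `&` F = set0 -> L (E `|` F) = L E + L F.
Hypothesis PL : forall A B, measurable A -> measurable B ->
  P (A `*` B) = (L (A `*` B))%:E.

Let additive_setUI E F : L (E `|` F) + L (E `&` F) = L E + L F.
Proof.
have -> : E `|` F = E `|` (F `\` E) by rewrite setDE setUIr setUCr setIT.
rewrite L_additive ?setDIK// -addrA; congr (_ + _).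
rewrite -L_additive; last by apply/seteqP; split => // x [[_ nE] [/nE]].
by congr L; rewrite setDE (setIC E) -setIUr setUC setUCr setIT.
Qed.

(* Inclusion-exclusion: the intersection with a rectangle makes the induction
   hypothesis available for all three terms. *)
Let additive_rect_bigcup n (A B : (set X)^nat) (A0 B0 : set X) :
  (forall k, measurable (A k)) -> (forall k, measurable (B k)) ->
  measurable A0 -> measurable B0 ->
  let E := (A0 `*` B0) `&` \big[setU/set0]_(k < n) (A k `*` B k) in
  P E = (L E)%:E.
Proof.
move=> mA mB; elim: n A0 B0 => [|n IH] A0 B0 mA0 mB0 /=.
  rewrite big_ord0 setI0 measure0.
  by congr EFin; have := L_additive (setI0 set0); rewrite setU0; lra.
rewrite big_ord_recr/= setIUr.
set U := \big[setU/set0]_(k < n) _.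
have mU : measurable U.
  by apply: bigsetU_measurable => k _; exact: measurableX.
have mR0 : measurable (A0 `*` B0) by exact: measurableX.
have mRn : measurable (A n `*` B n) by exact: measurableX.
set E := _ `&` U; set F := _ `&` (A n `*` B n).
have -> : (P (E `|` F) = P E + P F - P (E `&` F))%E.
  apply: measureUfinl; [exact: measurableI|exact: measurableI|].
  by rewrite ltey_eq fin_num_measure//; exact: measurableI.
have -> : E `&` F =
    ((A0 `&` A n) `*` (B0 `&` B n)) `&` U.
  apply/seteqP; split => -[x y].
    by move=> [[[/= a b] u] [_ [/= a' b']]].
  by move=> [[/= [a a'] [b b']] u].
have FE : F = (A0 `&` A n) `*` (B0 `&` B n) by rewrite /F setXI.
rewrite (IH A0 B0)// (IH (A0 `&` A n) (B0 `&` B n))//; try exact: measurableI.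
rewrite FE (PL (measurableI _ _ mA0 (mA n)) (measurableI _ _ mB0 (mB n))).
suff -> : L (E `|` (A0 `&` A n) `*` (B0 `&` B n)) = L E +
  L ((A0 `&` A n) `*` (B0 `&` B n)) - L ((A0 `&` A n) `*` (B0 `&` B n) `&` U) by [].
have := additive_setUI E ((A0 `&` A n) `*` (B0 `&` B n)).
have -> : E `&` ((A0 `&` A n) `*` (B0 `&` B n)) =
    ((A0 `&` A n) `*` (B0 `&` B n)) `&` U.
  apply/seteqP; split => -[x y].
    by move=> [[[/= a b] u] [/= [_ a'] [_ b']]].
  by move=> [[/= [a a'] [b b']] u].
by move=> <-; rewrite addrK.
Qed.

(** [P] equals [L] on finite unions and is continuous along them, whereas [L] is merely monotone
    along them. Equality thus degrades to an inequality, in the direction that bounds the cost from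
    above. *)
Lemma bigcup_rect_le (A B : (set X)^nat) :
  (forall k, measurable (A k)) -> (forall k, measurable (B k)) ->
  (P (\bigcup_k (A k `*` B k)) <= (L (\bigcup_k (A k `*` B k)))%:E)%E.
Proof.
move=> mA mB; pose U n := \big[setU/set0]_(k < n) (A k `*` B k).
have mU n : measurable (U n).
  by apply: bigsetU_measurable => k _; exact: measurableX.
have UE : \bigcup_k (A k `*` B k) = \bigcup_n U n.
  apply/seteqP; split => [x [k _ ABx]|x [n _]].
    by exists k.+1 => //; rewrite /U big_ord_recr; right.
  by rewrite /U -(bigcup_mkord n (fun k => A k `*` B k)) => -[k _ ABx]; exists k.
have homoU : {homo U : n m / (n <= m)%N >-> (n <= m)%O}.
  move=> n m nm; apply/subsetPset => x.
  rewrite /U -!(bigcup_mkord _ (fun k => A k `*` B k)) => -[k /= kn ABx].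
  by exists k => //=; exact: leq_trans nm.
have mUU : measurable (\bigcup_n U n) by exact: bigcupT_measurable.
have := nondecreasing_cvg_mu (mu := P) mU mUU homoU.
rewrite {1}UE => cU; rewrite -(cvg_lim _ cU)//; apply: lime_le.
  by apply/cvg_ex; eexists; exact: cU.
apply: nearW => n; rewrite /=.
have := @additive_rect_bigcup n A B setT setT mA mB measurableT measurableT.
rewrite setXTT setTI => ->; rewrite lee_fin.
rewrite UE -(setDUK (bigcup_sup (I : setT n))) L_additive ?lerDl//.
by rewrite setDIK.
Qed.

End additive_rectangles.

(** * Kantorovich duality *)

Section layer_cake.
Context {R : realType}.
Variable h : R.
Hypothesis h_gt0 : 0 < h.

(** A staircase under c: starting the thresholds at h and not at 0 keeps it below c, at the price of
    an error of at most h once n is large. *)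
Let step (c : R) (n : nat) : R := \sum_(k < n) (if k.+1%:R * h < c then h else 0).

(** The third clause carries the induction: while n h is below c no step has been omitted, so the
    value is known exactly. *)
Let stepP (c : R) n : 0 <= c -> [/\ step c n <= c,
  c <= n%:R * h + h -> c <= h + step c n & n%:R * h < c -> step c n = n%:R * h].
Proof.
move=> c0; elim: n => [|n [IH1 IH2 IH3]].
  by rewrite /step big_ord0; split => //; lra.
rewrite /step big_ord_recr/= -/(step c n) -natr1 mulrDl mul1r.
case: ltP => cn; last by split; [lra|move=> _; have := IH2 cn; lra|lra].
move: IH1 IH2 IH3 cn; set m := n%:R * h => IH1 IH2 IH3 cn.
have h0 := h_gt0; have /IH3 -> : m < c by lra.
by split; lra.
Qed.

Lemma layer_cake_le (c : R) n : 0 <= c -> step c n <= c.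
Proof. by case/(stepP n). Qed.

Lemma layer_cake_ge (c : R) : 0 <= c -> exists n, c <= h + step c n.
Proof.
move=> c0; exists (Num.truncn (c / h)).+1.
have [_ + _] := stepP (Num.truncn (c / h)).+1 c0; apply.
have : c / h < (Num.truncn (c / h)).+1%:R by exact: truncnS_gt.
by rewrite ltr_pdivrMr// => /ltW /le_trans; apply; rewrite lerDl ltW.
Qed.

End layer_cake.

Section kantorovich_duality.
Context {d : measure_display} {R : realType}.
Variable X : completeMetricMeasurableType d R.
Hypothesis X_borel : borel_measurable X.
Hypothesis X_proper : compact_closed_balls X.
Variables nu mu : probability X R.
Variable cost : X * X -> R.
Hypothesis cost_ge0 : forall z, 0 <= cost z.
Hypothesis cost_open : forall s : R, exists A B : (set X)^nat,
  [/\ forall k, measurable (A k), forall k, measurable (B k) &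
    [set z | s < cost z] = \bigcup_k (A k `*` B k)].
Variable K : R.
Hypothesis dual_le : forall psi phi : X -> R,
  bounded_measurable psi -> bounded_measurable phi ->
  (forall x y, psi x <= phi y + cost (x, y)) ->
  \int[nu]_x psi x <= \int[mu]_x phi x + K.

Let K_ge0 : 0 <= K.
Proof.
have b0 := @bounded_measurable_cst _ X _ (0 : R).
have /= := dual_le b0 b0; rewrite !probability_Rintegral_cst add0r; apply.
by move=> x y; rewrite add0r.
Qed.

(** The homogeneous form of [dual_le], which is the case t = 1 up to the sign of [psi]. It makes the
    dual value below finite, and equal to 0 at 0. *)
Let dual_ge0 (psi phi : X -> R) (t : R) :
  bounded_measurable psi -> bounded_measurable phi -> 0 <= t ->
  (forall z, 0 <= psi z.1 + phi z.2 + t * cost z) ->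
  0 <= \int[nu]_x psi x + \int[mu]_x phi x + t * K.
Proof.
move=> bpsi bphi t0 h; apply/ler_addgt0Pr => e e0.
have K10 : 0 < K + 1 by have := K_ge0; lra.
(* Division by t fails at t = 0, hence a slightly larger multiple of the cost. The excess is charged
   at rate K, so at most e in total; K + 1 is positive even if K = 0. *)
pose s := t + e / (K + 1); have s0 : 0 < s by rewrite ltr_wpDl// divr_gt0.
have := dual_le (bounded_measurableZ (- s^-1) bpsi) (bounded_measurableZ s^-1 bphi).
rewrite !bounded_RintegralZ// => dual.
have {}dual : - s^-1 * \int[nu]_x psi x <= s^-1 * \int[mu]_x phi x + K.
  apply: dual => x y; have /= := h (x, y).
  have : 0 <= e / (K + 1) * cost (x, y).
    by rewrite mulr_ge0// divr_ge0// ltW.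
  move=> h1 h2; rewrite -(ler_pM2l s0) mulrA mulrN mulfV ?gt_eqF//.
  by rewrite mulrDr mulrA mulfV ?gt_eqF// /s mulrDl; lra.
have := dual; rewrite -(ler_pM2l s0) mulrA mulrN mulfV ?gt_eqF//.
rewrite mulrDr mulrA mulfV ?gt_eqF// /s mulrDl.
have : e / (K + 1) * K <= e.
  have K1_neq0 : K + 1 != 0 by rewrite gt_eqF.
  rewrite -[leRHS](divfK K1_neq0).
  by rewrite ler_pM2l ?divr_gt0//; lra.
lra.
Qed.

Let V : lmodType R := (X * X)%type -> R^o.

Let bounded : set V := [set u | exists M : R, forall z, `|u z| <= M].

(** [inf (S u)] is a superhedging price: the cheapest way to dominate u by functions of one
    coordinate, priced by [nu] and [mu], and by t units of [cost], priced [K] each. A linear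
    functional below it has the right marginals and gives at most [K] to bounded functions dominated
    by [cost]. *)
Let S (u : V) : set R := [set r | exists psi phi t,
  [/\ bounded_measurable psi, bounded_measurable phi, 0 <= t,
    (forall z, u z <= psi z.1 + phi z.2 + t * cost z) &
    r = \int[nu]_x psi x + \int[mu]_x phi x + t * K]].

Let S_has_inf u : bounded u -> has_inf (S u).
Proof.
move=> [M uM]; split.
  exists (\int[nu]_x M + \int[mu]_x 0 + 0 * K), (fun=> M), (fun=> 0), 0.
  split => //; [exact: bounded_measurable_cst|exact: bounded_measurable_cst|].
  by move=> z; rewrite mul0r !addr0; exact: le_trans (ler_norm _) (uM z).
exists (- M) => _ [psi [phi [t [bpsi bphi t0 h ->]]]].
have bM := @bounded_measurable_cst _ X _ M.
have := dual_ge0 (bounded_measurableD bM bpsi) bphi t0.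
rewrite bounded_RintegralD// probability_Rintegral_cst => h1.
suff : 0 <= M + \int[nu]_x psi x + \int[mu]_x phi x + t * K by lra.
apply: h1 => z; have := h z; have := uM z.
by rewrite ler_norml => /andP[]; lra.
Qed.

Let S_inf_le u r : bounded u -> S u r -> inf (S u) <= r.
Proof. by move=> /S_has_inf[_ lS] Sr; exact: ge_inf. Qed.

Let bounded0 : bounded 0.
Proof. by exists 0 => z; rewrite normr0. Qed.

Let S0 r : 0 <= r -> forall u, (forall z, u z <= 0) -> S u (r * K).
Proof.
move=> r0 u u0; exists (fun=> 0), (fun=> 0), r; split => //.
- exact: bounded_measurable_cst.
- exact: bounded_measurable_cst.
- by move=> z; rewrite !add0r (le_trans (u0 z))// mulr_ge0.
- by rewrite !probability_Rintegral_cst !add0r.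
Qed.

Let boundedD u v : bounded u -> bounded v -> bounded (u + v).
Proof.
move=> [M uM] [N vN]; exists (M + N) => z.
by rewrite (le_trans (ler_normD _ _))// lerD.
Qed.

Let boundedZ (t : R) u : bounded u -> bounded (t *: u).
Proof.
by move=> [M uM]; exists (`|t| * M) => z; rewrite normrM ler_wpM2l.
Qed.

Let S_sublinear : sublinear_on bounded (fun u => inf (S u)).
Proof.
apply: (sublinear_on_inf boundedD boundedZ) => //.
- apply/eqP; rewrite eq_le; apply/andP; split.
    rewrite -[leRHS](mul0r K); apply: S_inf_le => //.
    exact: S0.
  apply: lb_le_inf; first by case: (S_has_inf bounded0).
  by move=> _ [psi [phi [t [bpsi bphi t0 h ->]]]]; exact: dual_ge0.
- move=> u v a b _ _ [psi1 [phi1 [t1 [bpsi1 bphi1 t10 h1 ->]]]].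
  move=> [psi2 [phi2 [t2 [bpsi2 bphi2 t20 h2 ->]]]].
  exists (\int[nu]_x (psi1 x + psi2 x) + \int[mu]_x (phi1 x + phi2 x) +
    (t1 + t2) * K).
    exists (fun x => psi1 x + psi2 x), (fun x => phi1 x + phi2 x), (t1 + t2).
    split => //; [exact: bounded_measurableD|exact: bounded_measurableD| |].
      exact: addr_ge0.
    by move=> z; have := h1 z; have := h2 z; rewrite mulrDl !fctE/=; lra.
  by rewrite !bounded_RintegralD// mulrDl; lra.
- move=> s u a s0 _ [psi [phi [t [bpsi bphi t0 h ->]]]].
  exists (\int[nu]_x (s * psi x) + \int[mu]_x (s * phi x) + (s * t) * K).
    exists (fun x => s * psi x), (fun x => s * phi x), (s * t).
    split => //; [exact: bounded_measurableZ|exact: bounded_measurableZ| |].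
      by rewrite mulr_ge0// ltW.
    move=> z; rewrite -mulrA -!mulrDr.
    by apply: ler_wpM2l; [exact: ltW|exact: h].
  by rewrite !bounded_RintegralZ//; lra.
Qed.

Let indicator (E : set (X * X)) : V := fun z => (\1_E z : R).

Let bounded_indicator E : bounded (indicator E).
Proof.
by exists 1 => z; rewrite /indicator indicE; case: (_ \in _); rewrite ?normr1 ?normr0.
Qed.

Theorem kantorovich_duality : exists2 pi, coupling nu mu pi &
  (\int[pi]_z (cost z)%:E <= K%:E)%E.
Proof.
have [Lam [LamD LamZ Lam_le]] :=
  hahn_banach_dominated bounded0 boundedD boundedZ S_sublinear.
have {}Lam_le u r : bounded u -> S u r -> Lam u <= r.
  by move=> bu Sr; apply: le_trans (Lam_le _ bu) (S_inf_le bu Sr).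
have LamN u : bounded u -> Lam (- u) = - Lam u.
  by move=> bu; rewrite -scaleN1r LamZ// mulN1r.
have boundedN u : bounded u -> bounded (- u).
  by move=> bu; rewrite -scaleN1r; exact: boundedZ.
(* Functions of this form and their opposites are hedged exactly with t = 0, so that domination
   becomes equality. *)
have LamE psi phi : bounded_measurable psi -> bounded_measurable phi ->
    Lam (fun z => psi z.1 + phi z.2) = \int[nu]_x psi x + \int[mu]_x phi x.
  move=> bpsi bphi; set u := (X in Lam X).
  have bu : bounded u.
    have [_ [M hM]] := bpsi; have [_ [N hN]] := bphi; exists (M + N) => z.
    by rewrite (le_trans (ler_normD _ _))// lerD.
  apply/eqP; rewrite eq_le; apply/andP; split.
    apply: Lam_le => //; exists psi, phi, 0.
    by split => //; [move=> z; rewrite mul0r addr0|rewrite mul0r addr0].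
  rewrite -lerN2 -LamN//; apply: Lam_le; first exact: boundedN.
  exists (fun x => -1 * psi x), (fun x => -1 * phi x), 0.
  split => //; [exact: bounded_measurableZ|exact: bounded_measurableZ| |].
    by move=> z; rewrite !mulN1r mul0r addr0 -opprD.
  by rewrite !bounded_RintegralZ//; lra.
have Lam_ge0 u : bounded u -> (forall z, 0 <= u z) -> 0 <= Lam u.
  move=> bu u0; rewrite -lerN2 oppr0 -LamN// -(mul0r K).
  apply: Lam_le; first exact: boundedN.
  by apply: S0 => // z; rewrite oppr_le0.
pose L E := Lam (indicator E).
have L_ge0 E : 0 <= L E.
  by apply: Lam_ge0 => // z; rewrite /indicator indicE.
have L_additive E F : E `&` F = set0 -> L (E `|` F) = L E + L F.
  move=> EF; rewrite /L -LamD//; congr Lam; apply/funext => z.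
  rewrite /indicator fctE !indicE in_setU.
  have [zE|] := boolP (z \in E); last by rewrite add0r.
  have [zF|_] := boolP (z \in F); last by rewrite addr0.
  have : (E `&` F) z by split; exact: set_mem.
  by rewrite EF.
have b0 := @bounded_measurable_cst _ X _ (0 : R).
have L_fst A : measurable A -> (L (fst @^-1` A))%:E = nu A.
  move=> mA; rewrite -probability_Rintegral_indic//; congr EFin.
  have := LamE _ _ (bounded_measurable_indic mA) b0.
  rewrite probability_Rintegral_cst addr0 => <-; congr Lam.
  by apply/funext => z; rewrite addr0.
have L_snd A : measurable A -> (L (snd @^-1` A))%:E = mu A.
  move=> mA; rewrite -probability_Rintegral_indic//; congr EFin.
  have := LamE _ _ b0 (bounded_measurable_indic mA).
  rewrite probability_Rintegral_cst add0r => <-; congr Lam.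
  by apply/funext => z; rewrite add0r.
have [pi piL] := probability_of_additive X_borel X_proper L_ge0 L_additive L_fst L_snd.
exists pi.
  move=> A mA; rewrite -setXT -setTX !piL// -L_fst// -L_snd//.
  by rewrite setXT setTX.
(* The slack h is the mesh of the staircase that replaces the possibly unbounded [cost]. *)
apply/lee_addgt0Pr => h h0.
pose U k := [set z | k.+1%:R * h < cost z].
have piU k : measurable (U k) /\ (pi (U k) <= (L (U k))%:E)%E.
  have [A [B [mA mB UAB]]] := cost_open (k.+1%:R * h).
  rewrite /U UAB.
  split; first by apply: bigcupT_measurable => j; exact: measurableX.
  exact: bigcup_rect_le.
have sumU z n : \sum_(k < n) h * \1_(U k) z =
    \sum_(k < n) (if k.+1%:R * h < cost z then h else 0).
  apply: eq_bigr => k _; rewrite indicE; case: ltP => zk.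
    by rewrite mem_set ?mulr1.
  by rewrite memNset ?mulr0//= /U/=; apply/negP; rewrite -leNgt.
have mcost : measurable_fun setT cost.
  apply: measurable_fun_superlevel => s.
  have [A [B [mA mB ->]]] := cost_open s.
  by apply: bigcupT_measurable => k; exact: measurableX.
have mU k : measurable_fun setT (fun z => (h * \1_(U k) z)%:E).
  apply/measurable_EFinP; apply: measurable_funM => //.
  by apply: measurable_indic; case: (piU k).
have U_ge0 k z : (0 <= (h * \1_(U k) z)%:E)%E.
  by rewrite lee_fin; apply: mulr_ge0; [exact: ltW|rewrite indicE].
apply: (@le_trans _ _
    (\int[pi]_z (h%:E + \sum_(k <oo) (h * \1_(U k) z)%:E))%E).
  apply: ge0_le_integral => //.
  - by move=> z _; rewrite lee_fin.
  - exact/measurable_EFinP.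
  - apply: emeasurable_funD => //.
    by apply: ge0_emeasurable_sum => // k z _ _; exact: U_ge0.
  - move=> z _; have [n] := layer_cake_ge h0 (cost_ge0 z).
    rewrite -sumU => cn.
    apply: (@le_trans _ _ (h%:E + (\sum_(k < n) h * \1_(U k) z)%:E)%E).
      by rewrite -EFinD lee_fin.
    apply: leeD => //; rewrite -sumEFin.
    apply: le_trans (nneseries_lim_ge n _) => //.
    by rewrite big_mkord.
rewrite ge0_integralD//; last 3 first.
- by move=> z _; rewrite lee_fin ltW.
- by move=> z _; rewrite nneseries_ge0.
- by apply: ge0_emeasurable_sum => // k z _ _; exact: U_ge0.
rewrite probability_integral_cst addeC.
apply: leeD => //; rewrite integral_nneseries//.
apply: lime_le; first by apply: is_cvg_nneseries => k _ _; exact: integral_ge0.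
apply: nearW => n; rewrite big_mkord.
apply: (@le_trans _ _ (\sum_(k < n) (h * L (U k))%:E)%E).
  apply: lee_sum => k _; under eq_integral do rewrite EFinM.
  have [mUk Uk] := piU k.
  have -> : (\int[pi]_z (h%:E * (\1_(U k) z)%:E) = h%:E * pi (U k))%E.
    rewrite ge0_integralZl//; first by rewrite integral_indic// setIT.
    - by apply/measurable_EFinP; exact: measurable_indic.
    - by rewrite lee_fin ltW.
  by rewrite EFinM; apply: lee_wpmul2l => //; rewrite lee_fin ltW.
rewrite sumEFin lee_fin.
have [bU LU] : bounded (fun z => \sum_(k < n) h * \1_(U k) z) /\
    Lam (fun z => \sum_(k < n) h * \1_(U k) z) = \sum_(k < n) h * L (U k).
  elim: n => [|n [bn IH]].
    rewrite (_ : (fun _ => _) = 0); last by apply/funext => z; rewrite big_ord0.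
    by split => //; rewrite -(scale0r (0 : V)) LamZ// mul0r big_ord0.
  rewrite (_ : (fun _ => _) = (fun z => \sum_(k < n) h * \1_(U k) z) +
      h *: indicator (U n)); last first.
    by apply/funext => z; rewrite big_ord_recr.
  split; first by apply: boundedD => //; exact: boundedZ.
  by rewrite LamD ?LamZ//; [rewrite big_ord_recr/= IH|exact: boundedZ].
(* The staircase lies below one unit of [cost], whose price is [K]. *)
rewrite -LU; apply: Lam_le => //; exists (fun=> 0), (fun=> 0), 1; split => //.
- by move=> z; rewrite !add0r mul1r sumU; exact: layer_cake_le.
- by rewrite !probability_Rintegral_cst !add0r mul1r.
Qed.

End kantorovich_duality.

(** * Young functions and infimal convolutions *)

Section young.
Context {R : realType}.
Variable alpha : R -> R.
Hypothesis alpha_young : young_function alpha.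

Lemma young_le (s t : R) : 0 <= s -> s <= t -> alpha s <= alpha t.
Proof. exact: young_increasing. Qed.

Lemma young_chord (t s : R) : 0 <= s -> s <= 1 ->
  alpha (t + s) <= s * alpha (t + 1) + (1 - s) * alpha t.
Proof.
move=> s0 s1; have := young_convex alpha_young (Itv01 s0 s1).
move=> /(_ (t + 1) t (in_setT _) (in_setT _)).
rewrite convRE/= /unstable.onem; apply: le_trans.
rewrite le_eqVlt; apply/orP; left; apply/eqP; congr alpha.
by rewrite /conv/= /unstable.onem /GRing.scale/=; ring.
Qed.

(* Uniform on sublevel sets even though alpha may grow arbitrarily fast: the
   chord from [t] to [t + 1] has bounded slope there, and when alpha is bounded
   the sublevel set is everything. *)
Lemma young_modulus (M e : R) : 0 < e -> exists2 delta : R, 0 < delta &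
  forall t u, 0 <= t -> 0 <= u -> alpha t <= M -> u <= t + delta ->
    alpha u <= alpha t + e.
Proof.
move=> e0.
have [B B0 hB] : exists2 B : R, 0 <= B &
    forall t, 0 <= t -> alpha t <= M -> alpha (t + 1) <= B.
  have [[t0 [t00 Mt0]]|h] := pselect (exists t0, 0 <= t0 /\ M < alpha t0).
    exists (alpha (t0 + 1)) => [|t t_ge0 tM]; first exact: young_ge0.
    have : t <= t0.
      rewrite leNgt; apply/negP => /ltW tt0; have := young_le t00 tt0; lra.
    by move=> tt0; apply: young_le; lra.
  have hM t : 0 <= t -> alpha t <= M.
    by move=> t0; rewrite leNgt; apply/negP => Mt; apply: h; exists t.
  exists M => [|t t0 _]; last by apply: hM; lra.
  by apply: le_trans (hM 0 (lexx _)); rewrite (young0 alpha_young).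
have B1 : 0 < B + 1 by lra.
exists (Num.min 1 (e / (B + 1))) => [|t u t0 u0 tM].
  by rewrite lt_min ltr01 divr_gt0.
set s := Num.min _ _ => ut.
have s0 : 0 <= s by rewrite le_min ler01 divr_ge0// ltW.
have s1 : s <= 1 by rewrite ge_min lexx.
have se : s * (B + 1) <= e.
  by rewrite -ler_pdivlMr// ge_min lexx orbT.
apply: (le_trans (young_le u0 ut)).
apply: (le_trans (young_chord t s0 s1)).
have := ler_wpM2l s0 (hB _ t0 tM).
have := mulr_ge0 s0 (young_ge0 alpha_young t); lra.
Qed.

End young.

Section infimal_convolution.
Context {R : realType} {T : pointedType}.
Variable cost : T -> T -> R.
Hypothesis cost_ge0 : forall x y, 0 <= cost x y.
Hypothesis cost_diag : forall x, cost x x = 0.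

(** The cost is arbitrary because three are used: the one on X, its sum over tuples, and multiples
    of the distance for Lipschitz regularization. *)
Definition infconv (f : T -> R) (x : T) : R :=
  inf [set f y + cost x y | y in [set: T]].

Variable f : T -> R.
Hypothesis f_ge0 : forall x, 0 <= f x.

Lemma infconv_has_inf x : has_inf [set f y + cost x y | y in [set: T]].
Proof.
split; first by exists (f point + cost x point), point.
by exists 0 => _ [y _ <-]; rewrite addr_ge0.
Qed.

Lemma infconv_le x y : infconv f x <= f y + cost x y.
Proof. by apply: ge_inf; [case: (infconv_has_inf x)|exists y]. Qed.

Lemma le_infconv x r : (forall y, r <= f y + cost x y) -> r <= infconv f x.
Proof.
move=> h; apply: lb_le_inf; first by case: (infconv_has_inf x).
by move=> _ [y _ <-].
Qed.

Lemma infconv_lt x r : infconv f x < r -> exists y, f y + cost x y < r.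
Proof.
move=> xr; have e0 : 0 < r - infconv f x by rewrite subr_gt0.
have [_ [y _ <-]] := inf_adherent e0 (infconv_has_inf x).
by rewrite -/(infconv f x) addrCA subrr addr0; exists y.
Qed.

Lemma infconv_ge0 x : 0 <= infconv f x.
Proof. by apply: le_infconv => y; rewrite addr_ge0. Qed.

Lemma infconv_le_fun x : infconv f x <= f x.
Proof. by rewrite -[leRHS]addr0 -(cost_diag x); exact: infconv_le. Qed.

End infimal_convolution.

Section metric_products.
Context {d : measure_display} {R : realType}.
Variable X : completeMetricMeasurableType d R.
Hypothesis X_borel : borel_measurable X.
Hypothesis X_separable : separable X.

Lemma countable_metric_base : exists b : (set X)^nat,
  (forall k, measurable (b k)) /\
  forall x (e : R), 0 < e ->
    exists2 k, b k x & forall y, b k y -> mdist x y < e.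
Proof.
have [S cS dS] := X_separable.
have [s sS] : exists s : nat -> X, S `<=` range s.
  have [->|/set0P[x0 Sx0]] := eqVneq S set0; first by exists (fun=> point).
  have /pcard_surjP[g gS] : (S #<= [set: nat])%card by [].
  by exists g => x Sx; have [n _ <-] := gS x Sx; exists n.
pose b (p : nat * nat) := [set y : X | mdist (s p.1) y < p.2.+1%:R^-1 :> R].
exists (fun k => if choice.unpickle k is Some p then b p else set0); split => [k|x e e0].
  case: choice.unpickle => // p; apply: open_borel => //; exact: open_mdist_ball.
pose m := Num.truncn (2 / e).
have me : m.+1%:R^-1 < e / 2 :> R.
  rewrite -[ltRHS]invf_div ltf_pV2 ?posrE// ?divr_gt0//; exact: truncnS_gt.
have m0 : 0 < m.+1%:R^-1 :> R by rewrite invr_gt0.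
have xB : [set y : X | mdist x y < m.+1%:R^-1] x by rewrite /= mdistxx.
have [z [Bz Sz]] := dS _ (ex_intro _ x xB) (@open_mdist_ball _ _ X x m.+1%:R^-1).
have [n _ nz] := sS z Sz.
exists (choice.pickle (n, m)); rewrite choice.pickleK /b/= nz.
  by rewrite metric_sym.
move=> y /= zy; apply: (le_lt_trans (metric_triangle x z y)).
by rewrite (splitr e); apply: ltrD; apply: lt_trans me.
Qed.

(** The sigma-algebra on tuples is generated by the coordinates. It contains the open sets because,
    with a countable base, U is a countable union of the boxes that it contains. *)
Lemma measurable_tuple_open n (U : set (n.-tuple X)) :
  (forall x, U x -> exists2 e : R, 0 < e &
     forall y, (forall i, mdist (tnth x i) (tnth y i) < e) -> U y) ->
  measurable U.
Proof.
move=> Uo; have [b [mb bP]] := countable_metric_base.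
pose box (k : n.-tuple nat) :=
  [set x : n.-tuple X | forall i, b (tnth k i) (tnth x i)].
have mbox k : measurable (box k).
  rewrite (_ : box k = \bigcap_(i in [set: 'I_n])
      ((fun x : n.-tuple X => tnth x i) @^-1` b (tnth k i))).
    apply: fin_bigcap_measurable => [|i _]; first exact: finite_finset.
    by rewrite -[X in measurable X]setTI; exact: measurable_tnth.
  by apply/seteqP; split => x /= h i; [move=> _; exact: h|exact: h].
pose I := [set k | box k `<=` U].
rewrite (_ : U = \bigcup_k (if `[< I k >] then box k else set0)).
  apply: countable_bigcupT_measurable => [|k]; first exact: countableP.
  by case: ifP.
apply/seteqP; split => [x Ux|x [k _]]; last by case: asboolP => // Ik /Ik.
have [e e0 eU] := Uo x Ux.
have /choice[k kP] : forall i : 'I_n, exists k,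
    b k (tnth x i) /\ forall y, b k y -> mdist (tnth x i) y < e.
  by move=> i; have [k ? ?] := bP (tnth x i) e e0; exists k.
exists [tuple k i | i < n] => //; case: asboolP => [_ i|].
  by rewrite tnth_mktuple; case: (kP i).
case=> y yk; apply: eU => i; have := yk i; rewrite tnth_mktuple.
by case: (kP i) => _; apply.
Qed.

Lemma open_bigcup_rect (U : set (X * X)) :
  (forall z, U z -> exists2 e : R, 0 < e & forall z', mdist z.1 z'.1 < e ->
     mdist z.2 z'.2 < e -> U z') ->
  exists A B : (set X)^nat, [/\ forall k, measurable (A k),
    forall k, measurable (B k) & U = \bigcup_k (A k `*` B k)].
Proof.
move=> Uo; have [b [mb bP]] := countable_metric_base.
pose I (p : nat * nat) := b p.1 `*` b p.2 `<=` U.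
pose C (k : nat) := if choice.unpickle k is Some p then
  (if `[< I p >] then (b p.1, b p.2) else (set0, set0)) else (set0, set0).
exists (fun k => (C k).1), (fun k => (C k).2); split.
- move=> k; rewrite /C; case: choice.unpickle => [p|]; last exact: measurable0.
  by case: ifP => _; [exact: mb|exact: measurable0].
- move=> k; rewrite /C; case: choice.unpickle => [p|]; last exact: measurable0.
  by case: ifP => _; [exact: mb|exact: measurable0].
apply/seteqP; split => [z Uz|z [k _]].
  have [e e0 eU] := Uo z Uz.
  have [i bi ie] := bP z.1 e e0; have [j bj je] := bP z.2 e e0.
  exists (choice.pickle (i, j)) => //; rewrite /C choice.pickleK.
  case: asboolP => [//|]; case=> z' [/= bz1 bz2].
  by apply: eU; [exact: ie|exact: je].
rewrite /C; case: choice.unpickle => [p|]; last by case.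
by case: asboolP => [Ip /Ip//|_ []].
Qed.

Variable alpha : R -> R.
Hypothesis alpha_young : young_function alpha.

Lemma young_mdist_open (s : R) : exists A B : (set X)^nat,
  [/\ forall k, measurable (A k), forall k, measurable (B k) &
    [set z | s < alpha (mdist z.1 z.2)] = \bigcup_k (A k `*` B k)].
Proof.
apply: open_bigcup_rect => -[x y] /= sxy.
have e0 : 0 < (alpha (mdist x y) - s) / 2 by lra.
have [delta d0 dP] := young_modulus alpha_young (alpha (mdist x y)) e0.
exists (delta / 2); first by rewrite divr_gt0.
move=> [x' y'] /= xx' yy'; rewrite ltNge; apply/negP => sxy'.
suff : alpha (mdist x y) < alpha (mdist x y) by rewrite ltxx.
have [lexy|ltxy] := leP (mdist x y) (mdist x' y').
  by have := young_le alpha_young (mdist_ge0 x y) lexy; lra.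
(* The perturbed pair is assumed to have cost at most s, so the modulus on this sublevel set applies
   at the perturbed distance. *)
have M' : alpha (mdist x' y') <= alpha (mdist x y) by lra.
have := dP (mdist x' y') (mdist x y) (mdist_ge0 _ _) (mdist_ge0 _ _) M'.
have : mdist x y <= mdist x' y' + delta.
  have := metric_triangle x x' y; have := metric_triangle x' y' y.
  by rewrite (metric_sym y' y); lra.
by move=> h /(_ h); lra.
Qed.

End metric_products.

(** * Entropy *)

(* No integrability is required: the positive and negative parts are compared
   separately, and subtraction in [\bar R] is monotone. *)
Lemma le_integral_measurable {d} {T : measurableType d} {R : realType}
    (mu : {measure set T -> \bar R}) (f g : T -> \bar R) :
  measurable_fun setT f -> measurable_fun setT g ->
  (forall x, f x <= g x)%E -> (\int[mu]_x f x <= \int[mu]_x g x)%E.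
Proof.
move=> mf mg fg; rewrite [leLHS]integralE [leRHS]integralE; apply: leeB.
  apply: ge0_le_integral => //; [exact: measurable_funepos|
    exact: measurable_funepos|].
  by move=> x _; apply: (@funepos_le _ _ setT f g) => [y _ //|]; exact: in_setT.
apply: ge0_le_integral => //; [exact: measurable_funeneg|
  exact: measurable_funeneg|].
by move=> x _; apply: (@funeneg_le _ _ setT f g) => [y _ //|]; exact: in_setT.
Qed.

Lemma bounded_measurable_expR {d} {T : measurableType d} {R : realType}
    (g : T -> R) :
  bounded_measurable g -> bounded_measurable (fun x => expR (g x)).
Proof.
move=> [mg [M gM]]; split; first exact: measurableT_comp.
exists (expR M) => x; rewrite ger0_norm ?expR_ge0// ler_expR.
exact: le_trans (ler_norm _) (gM x).
Qed.

Lemma measurable_lne {d} {T : measurableType d} {R : realType}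
    (f : T -> \bar R) : measurable_fun setT f ->
  (forall x, f x \is a fin_num) -> measurable_fun setT (@lne R \o f).
Proof.
move=> mf ff; rewrite (_ : @lne R \o f = fun x =>
    if fine (f x) <= 0 then -oo%E else (ln (fine (f x)))%:E); last first.
  by apply/funext => x /=; case: (f x) (ff x).
have mff : measurable_fun setT (fine \o f).
  by apply: measurableT_comp => //; exact: fine_measurable.
apply: measurable_fun_ifT => //.
  exact: measurable_fun_ler.
by apply/measurable_EFinP; exact: measurableT_comp.
Qed.

Section entropy.
Context {d : measure_display} {T : measurableType d} {R : realType}.
Variable mu : probability T R.

Lemma Rintegral_expR_gt0 (g : T -> R) : bounded_measurable g ->
  0 < \int[mu]_x expR (g x).
Proof.
move=> bg; have [_ [M gM]] := bg.
apply: (@lt_le_trans _ _ (\int[mu]_x expR (- M))).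
  by rewrite probability_Rintegral_cst expR_gt0.
apply: bounded_le_Rintegral; [exact: bounded_measurable_cst|
  exact: bounded_measurable_expR|].
by move=> x; rewrite ler_expR; have := gM x; rewrite ler_norml => /andP[].
Qed.

(* Integrating [1 + y <= expR y] at [y = g - ln (Z h)], where [h] is the density
   of [nu] and [Z] the integral of [expR g]. *)
Lemma gibbs_inequality (nu : probability T R) (g : T -> R) :
  bounded_measurable g ->
  ((\int[nu]_x g x - ln (\int[mu]_x expR (g x)))%:E
     <= relative_entropy nu mu)%E.
Proof.
move=> bg; rewrite /relative_entropy; case: asboolP => [numu|_]; last exact: leey.
set Z := \int[mu]_x expR (g x); have Z0 : 0 < Z := Rintegral_expR_gt0 bg.
set rho := Radon_Nikodym _ _.
(* A nonnegative finite version of the density; [rho] agrees with it only almost everywhere. *)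
pose F := Radon_Nikodym_SigmaFinite.f nu mu.
have F_ge0 x : (0 <= F x)%E by exact: Radon_Nikodym_SigmaFinite.f_ge0.
have F_fin x : F x \is a fin_num by exact: Radon_Nikodym_SigmaFinite.f_fin_num.
have mF : measurable_fun setT F.
  exact: measurable_int (Radon_Nikodym_SigmaFinite.f_integrable numu).
pose h x := fine (F x).
have h_ge0 x : 0 <= h x by exact: fine_ge0.
have FE x : F x = (h x)%:E by rewrite fineK.
have mh : measurable_fun setT h.
  by apply: (measurableT_comp (fine_measurable measurableT)).
have mpos : measurable_fun setT (fun x => 0 < h x) by exact: measurable_fun_ltr.
pose g1 x := g x + (- ln Z).
have bg1 : bounded_measurable g1.
  by apply: bounded_measurableD => //; exact: bounded_measurable_cst.
(* With value 0 where h vanishes, the [nu]-integral of q is the [mu]-integral of [expR (g1 x)] over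
   the set where h is positive, hence at most 1 since g1 is normalized by [ln Z]. *)
pose q x := if 0 < h x then expR (g1 x - ln (h x)) else 0.
have mq : measurable_fun setT q.
  apply: measurable_fun_ifT => //; apply: measurableT_comp => //.
  by apply: measurable_funB; [exact: bg1.1|exact: measurableT_comp].
have q_ge0 x : 0 <= q x by rewrite /q; case: ifP => // _; exact: expR_ge0.
have q_le1 : (\int[nu]_x (q x)%:E <= 1)%E.
  rewrite -(Radon_Nikodym_SigmaFinite.change_of_variables numu)//; last exact/measurable_EFinP.
  apply: (@le_trans _ _ (\int[mu]_x (expR (g1 x))%:E)%E).
    apply: ge0_le_integral => //.
    + by move=> x _; rewrite mule_ge0// lee_fin.
    + by apply: emeasurable_funM => //; exact/measurable_EFinP.
    + exact/measurable_EFinP/(bounded_measurable_expR bg1).1.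
    + move=> x _; rewrite -/(F x) FE -EFinM lee_fin /q.
      case: ltP => hx; last by rewrite mul0r expR_ge0.
      by rewrite expRB lnK ?posrE// divfK// gt_eqF.
  rewrite integral_bounded; last exact: bounded_measurable_expR.
  under eq_Rintegral do rewrite /g1 expRD expRN lnK ?posrE// mulrC.
  rewrite bounded_RintegralZ; last exact: bounded_measurable_expR.
  by rewrite mulVf// gt_eqF.
have iq : nu.-integrable setT (EFin \o q).
  apply/integrableP; split; first exact/measurable_EFinP.
  under eq_integral do rewrite /= ger0_norm//.
  by rewrite (le_lt_trans q_le1)// ltry.
pose w x := g1 x + 1 - q x.
have bg11 : bounded_measurable (fun x => g1 x + 1).
  by apply: bounded_measurableD => //; exact: bounded_measurable_cst.
have mw : measurable_fun setT w by apply: measurable_funB => //; exact: bg11.1.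
(* The default [w x] on the [nu]-null set where h vanishes makes w at most l everywhere. *)
pose l x := if 0 < h x then ln (h x) else w x.
have wl x : w x <= l x.
  rewrite /l; case: ifP => // hx; rewrite /w /q hx.
  by have := expR_ge1Dx (g1 x - ln (h x)); lra.
have ml : measurable_fun setT l.
  by apply: measurable_fun_ifT => //; exact: measurableT_comp.
have h_pos : {ae nu, forall x, 0 < h x}.
  have mN : measurable [set x | h x <= 0].
    rewrite -[X in measurable X]setTI.
    exact: (measurable_fun_ler mh (measurable_cst (0 : R))) measurableT [set true] _.
  exists [set x | h x <= 0]; split => //.
    rewrite (Radon_Nikodym_SigmaFinite.f_integral numu mN).
    apply: integral0_eq => x /= hx; rewrite -/(F x) FE.
    by congr EFin; apply/eqP; rewrite eq_le hx h_ge0.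
  by move=> x /= /negP; rewrite -leNgt.
have lE : (\int[nu]_x lne (rho x) = \int[nu]_x (l x)%:E)%E.
  apply: ae_eq_integral => //.
  - apply: measurable_lne => [|x].
      exact: measurable_int (@Radon_Nikodym_integrable _ _ _
        (charge_of_finite_measure nu) mu numu).
    exact: Radon_Nikodym_fin_num.
  - exact/measurable_EFinP.
  - have := ae_eq_Radon_Nikodym_SigmaFinite numu measurableT.
    move=> /(null_dominates_ae_eq measurableT numu).
    apply: filterS2 h_pos => x hx /(_ I) rhoE _.
    by rewrite -[rho x]rhoE -/(F x) FE /= leNgt hx /l hx.
rewrite lE; apply: (@le_trans _ _ (\int[nu]_x (w x)%:E)%E); last first.
  apply: le_integral_measurable; [exact/measurable_EFinP|exact/measurable_EFinP|].
  by move=> x; rewrite lee_fin.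
have -> : (\int[nu]_x (w x)%:E =
    (\int[nu]_x (g1 x + 1))%:E - \int[nu]_x (q x)%:E)%E.
  rewrite -integral_bounded// -integralB//.
  exact: bounded_measurable_integrable.
rewrite leeBrDr; last exact: integrable_fin_num.
rewrite !bounded_RintegralD//; try exact: bounded_measurable_cst.
rewrite !probability_Rintegral_cst.
apply: (@le_trans _ _ ((\int[nu]_x g x - ln Z)%:E + 1%:E)%E).
  exact: leeD.
by rewrite -EFinD lee_fin.
Qed.

End entropy.

(** * From the transport inequality to exponential integrals *)

Section tilting.
Context {d : measure_display} {T : measurableType d} {R : realType}.
Variables (mu : probability T R) (g : T -> R).
Hypothesis bg : bounded_measurable g.

Let Z := \int[mu]_x expR (g x).

Let Z_gt0 : 0 < Z. Proof. exact: Rintegral_expR_gt0. Qed.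

Let density (x : T) : R := Z^-1 * expR (g x).

Let density_ge0 x : 0 <= density x.
Proof. by rewrite mulr_ge0 ?expR_ge0// invr_ge0 ltW. Qed.

Let bounded_density : bounded_measurable density.
Proof. exact/bounded_measurableZ/bounded_measurable_expR. Qed.

Let measurable_density : measurable_fun setT (EFin \o density).
Proof. by apply/measurable_EFinP; case: bounded_density. Qed.

Let tilt (A : set T) : \bar R := (\int[mu]_(x in A) (density x)%:E)%E.

Let tilt0 : tilt set0 = 0%E.
Proof. by rewrite /tilt integral_set0. Qed.

Let tilt_ge0 A : (0 <= tilt A)%E.
Proof. by apply: integral_ge0 => x _; rewrite lee_fin. Qed.

Let tilt_semi_sigma_additive : semi_sigma_additive tilt.
Proof.
move=> F mF tF mUF; rewrite /tilt ge0_integral_bigcup//.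
- apply: is_cvg_ereal_nneg_natsum_cond => n _ _.
  by apply: integral_ge0 => x _; rewrite lee_fin.
- exact: measurable_funTS.
- by move=> x _; rewrite lee_fin.
Qed.

HB.instance Definition _ := isMeasure.Build _ _ _ tilt
  tilt0 tilt_ge0 tilt_semi_sigma_additive.

Let tilt_setT : tilt setT = 1%E.
Proof.
rewrite /tilt integral_bounded// /density bounded_RintegralZ; last first.
  exact: bounded_measurable_expR.
by rewrite mulVf// gt_eqF.
Qed.

HB.instance Definition _ := Measure_isProbability.Build _ _ _ tilt tilt_setT.

(** The equality case of Gibbs' inequality: the logarithm of the density is g - ln Z, which is
    bounded, so the entropy is finite and computed exactly. *)
Lemma tilted_probability : exists nu : probability T R,
  relative_entropy nu mu =
    (\int[nu]_x g x - ln (\int[mu]_x expR (g x)))%:E.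
Proof.
pose nu : probability T R := tilt; exists nu.
have numu : nu `<< mu.
  apply/null_content_dominatesP => A mA muA0; rewrite /nu/= /tilt.
  by rewrite (null_set_integral mA _ muA0)//; exact: measurable_funTS.
rewrite /relative_entropy; case: asboolP => // _.
set rho := Radon_Nikodym _ _.
have irho : mu.-integrable setT rho := @Radon_Nikodym_integrable _ _ _
  (charge_of_finite_measure nu) mu numu.
have rhoE : ae_eq mu setT (EFin \o density) rho.
  apply: integral_ae_eq => //.
  - exact: bounded_measurable_integrable.
  - exact: measurable_int irho.
  - move=> E _ mE.
    by rewrite -(@Radon_Nikodym_integral _ _ _ (charge_of_finite_measure nu) mu E).
have bgZ : bounded_measurable (fun x => g x + (- ln Z)).
  by apply: bounded_measurableD => //; exact: bounded_measurable_cst.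
have -> : (\int[nu]_x lne (rho x) = \int[nu]_x (g x + (- ln Z))%:E)%E.
  apply: ae_eq_integral => //.
  - apply: measurable_lne; first exact: measurable_int irho.
    by move=> x; exact: Radon_Nikodym_fin_num.
  - by apply/measurable_EFinP; case: bgZ.
  - have := null_dominates_ae_eq measurableT numu rhoE.
    apply: filterS => x /(_ I) <- _ /=.
    have dx : 0 < density x by rewrite mulr_gt0 ?invr_gt0 ?expR_gt0.
    rewrite leNgt dx/= /density lnM ?posrE ?invr_gt0 ?expR_gt0//.
    by rewrite expRK lnV ?posrE// addrC.
rewrite integral_bounded// bounded_RintegralD//; last exact: bounded_measurable_cst.
by rewrite probability_Rintegral_cst.
Qed.

End tilting.

(** * Infimal convolution with the transport cost, and the easy half of duality *)

Section young_infconv.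
Context {d : measure_display} {R : realType}.
Variable X : completeMetricMeasurableType d R.
Hypothesis X_borel : borel_measurable X.
Hypothesis X_separable : separable X.
Variable alpha : R -> R.
Hypothesis alpha_young : young_function alpha.

Definition young_cost (x y : X) : R := alpha (mdist x y).

Definition young_cost_tuple n (x y : n.-tuple X) : R :=
  \sum_(i < n) alpha (mdist (tnth x i) (tnth y i)).

Lemma young_cost_ge0 x y : 0 <= young_cost x y.
Proof. exact: young_ge0. Qed.

Lemma young_cost_diag x : young_cost x x = 0.
Proof. by rewrite /young_cost mdistxx (young0 alpha_young). Qed.

Lemma young_cost_tuple_ge0 n (x y : n.-tuple X) : 0 <= young_cost_tuple x y.
Proof. by apply: sumr_ge0 => i _; exact: young_ge0. Qed.

Lemma young_cost_tuple_diag n (x : n.-tuple X) : young_cost_tuple x x = 0.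
Proof. by apply: big1 => i _; rewrite mdistxx (young0 alpha_young). Qed.

(** Sublevel sets are open: by the modulus, a y that brings the value at x below s still does so at
    nearby points. *)
Lemma measurable_young_infconv (f : X -> R) : (forall x, 0 <= f x) ->
  measurable_fun setT (infconv young_cost f).
Proof.
move=> f0; apply: measurable_fun_sublevel => s; apply: open_borel => //.
apply: mdist_openP => x /= /infconv_lt-/(_ young_cost_ge0 f0)[y ys].
have e0 : 0 < (s - (f y + young_cost x y)) / 2 by lra.
have [delta d0 dP] := young_modulus alpha_young (young_cost x y) e0.
exists delta => // x' xx'; apply: le_lt_trans (infconv_le _ _ x' y) _ => //.
  exact: young_cost_ge0.
have := dP (mdist x y) (mdist x' y) (mdist_ge0 _ _) (mdist_ge0 _ _) (lexx _).
have -> : mdist x' y <= mdist x y + delta.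
  by have := metric_triangle x' x y; rewrite (metric_sym x' x); lra.
by move=> /(_ isT); rewrite -/(young_cost x' y) -/(young_cost x y); lra.
Qed.

Lemma measurable_young_infconv_tuple n (f : n.-tuple X -> R) :
  (forall x, 0 <= f x) ->
  measurable_fun setT (infconv (@young_cost_tuple n) f).
Proof.
move=> f0; apply: measurable_fun_sublevel => s.
apply: (measurable_tuple_open X_borel X_separable).
move=> x /= /infconv_lt-/(_ (@young_cost_tuple_ge0 n) f0)[y ys].
set r := s - (f y + young_cost_tuple x y).
have r0 : 0 < r by rewrite subr_gt0.
(* n errors of r / (n + 1) stay strictly below r, also when n = 0. *)
have e0 : 0 < r / n.+1%:R by rewrite divr_gt0.
have [delta d0 dP] := young_modulus alpha_young (young_cost_tuple x y) e0.
exists delta => // x' xx'; apply: le_lt_trans (infconv_le _ _ x' y) _ => //.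
  exact: young_cost_tuple_ge0.
suff : young_cost_tuple x' y <= young_cost_tuple x y + r / n.+1%:R *+ n.
  have : r / n.+1%:R *+ n < r.
    by rewrite -mulr_natr -mulrA gtr_pMr// mulrC ltr_pdivrMr// mul1r ltr_nat.
  by move: (r / _ *+ n) => k; rewrite /r; lra.
have -> : r / n.+1%:R *+ n = \sum_(i < n) r / n.+1%:R.
  by rewrite sumr_const card_ord.
rewrite -big_split/=; apply: ler_sum => i _; apply: dP => //; do ?exact: mdist_ge0.
  rewrite /young_cost_tuple (bigD1 i)//= lerDl.
  by apply: sumr_ge0 => j _; exact: young_ge0.
have := metric_triangle (tnth x' i) (tnth x i) (tnth y i).
by have := xx' i; rewrite (metric_sym (tnth x' i) (tnth x i)); lra.
Qed.

Lemma bounded_young_infconv (f : X -> R) : (forall x, 0 <= f x) ->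
  bounded_measurable f -> bounded_measurable (infconv young_cost f).
Proof.
move=> f0 [_ [M fM]]; split; first exact: measurable_young_infconv.
exists M => x; rewrite ger0_norm; last first.
  by apply: infconv_ge0 => //; exact: young_cost_ge0.
apply: le_trans (le_trans (ler_norm _) (fM x)); apply: infconv_le_fun => //.
- exact: young_cost_ge0.
- exact: young_cost_diag.
Qed.

Lemma bounded_young_infconv_tuple n (f : n.-tuple X -> R) :
  (forall x, 0 <= f x) -> bounded_measurable f ->
  bounded_measurable (infconv (@young_cost_tuple n) f).
Proof.
move=> f0 [_ [M fM]]; split; first exact: measurable_young_infconv_tuple.
exists M => x; rewrite ger0_norm; last first.
  by apply: infconv_ge0 => //; exact: young_cost_tuple_ge0.
apply: le_trans (le_trans (ler_norm _) (fM x)); apply: infconv_le_fun => //.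
- exact: young_cost_tuple_ge0.
- exact: young_cost_tuple_diag.
Qed.

Lemma measurable_young_mdist :
  measurable_fun setT (fun z : X * X => alpha (mdist z.1 z.2)).
Proof.
apply: measurable_fun_superlevel => s.
have [A [B [mA mB ->]]] := young_mdist_open X_borel X_separable alpha_young s.
by apply: bigcupT_measurable => k; exact: measurableX.
Qed.

Lemma coupling_fst (nu mu : probability X R) pi (f : X -> R) :
  coupling nu mu pi -> (forall x, 0 <= f x) -> measurable_fun setT f ->
  (\int[pi]_z (f z.1)%:E = \int[nu]_x (f x)%:E)%E.
Proof.
move=> cpi f0 mf; transitivity (\int[pushforward pi fst]_x (f x)%:E)%E.
  rewrite ge0_integral_pushforward//.
  - exact/measurable_EFinP.
  - by move=> x _; rewrite lee_fin.
by apply: eq_measure_integral => A mA _; case: (cpi A mA).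
Qed.

Lemma coupling_snd (nu mu : probability X R) pi (f : X -> R) :
  coupling nu mu pi -> (forall x, 0 <= f x) -> measurable_fun setT f ->
  (\int[pi]_z (f z.2)%:E = \int[mu]_x (f x)%:E)%E.
Proof.
move=> cpi f0 mf; transitivity (\int[pushforward pi snd]_x (f x)%:E)%E.
  rewrite ge0_integral_pushforward//.
  - exact/measurable_EFinP.
  - by move=> x _; rewrite lee_fin.
by apply: eq_measure_integral => A mA _; case: (cpi A mA).
Qed.

Lemma transport_cost_ge_dual (nu mu : probability X R) (f : X -> R) :
  bounded_measurable f -> (forall x, 0 <= f x) ->
  ((\int[nu]_x infconv young_cost f x - \int[mu]_x f x)%:E
     <= transport_cost alpha nu mu)%E.
Proof.
move=> bf f0; apply: le_ereal_inf_tmp => _ [pi cpi <-].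
have bQ := bounded_young_infconv f0 bf.
have Q0 x : 0 <= infconv young_cost f x.
  by apply: infconv_ge0 => //; exact: young_cost_ge0.
rewrite EFinB leeBlDr// -!integral_bounded//.
rewrite -(coupling_fst cpi)//; last by case: bQ.
rewrite -(coupling_snd cpi)//; last by case: bf.
have mf : measurable_fun setT (fun z : X * X => f z.2).
  by apply: measurableT_comp => //; case: bf.
rewrite -ge0_integralD//; first last.
- exact/measurable_EFinP.
- by move=> z _; rewrite lee_fin.
- by apply/measurable_EFinP; exact: measurable_young_mdist.
- by move=> z _; rewrite lee_fin young_ge0.
apply: ge0_le_integral => //.
- by move=> z _; rewrite lee_fin.
- by apply/measurable_EFinP; apply: measurableT_comp => //; case: bQ.
- by apply: emeasurable_funD; apply/measurable_EFinP => //; exact: measurable_young_mdist.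
- move=> z _; rewrite -EFinD lee_fin addrC.
  by apply: infconv_le => //; exact: young_cost_ge0.
Qed.

Variables (mu : probability X R) (c : R).
Hypothesis c_gt0 : 0 < c.

(** For the tilted measure, c times the transport inequality has c nu(Qf) on both sides; once it
    cancels, log Z <= c mu(f) remains. *)
Lemma transport_inequality_exp (f : X -> R) :
  transport_inequality alpha (1 / c) mu ->
  bounded_measurable f -> (forall x, 0 <= f x) ->
  \int[mu]_x expR (c * infconv young_cost f x) <= expR (c * \int[mu]_x f x).
Proof.
move=> Tmu bf f0; have bQ := bounded_young_infconv f0 bf.
have bcQ := bounded_measurableZ c bQ.
have [nu nuE] := tilted_probability mu bcQ.
have := le_trans (transport_cost_ge_dual nu mu bf f0) (Tmu nu).
rewrite nuE -EFinM lee_fin bounded_RintegralZ// -(ler_pM2l c_gt0).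
rewrite mulrA mulrCA divff ?gt_eqF// mulr1 mul1r mulrBr.
have Z0 := Rintegral_expR_gt0 mu bcQ => h.
by rewrite -ler_ln ?posrE ?expR_gt0// expRK; lra.
Qed.

End young_infconv.

(** * Tensorization *)

Section power_integral.
Context {d : measure_display} {T : measurableType d} {R : realType}.
Variable mu : probability T R.

Lemma measurable_tcons_section n (x : T) :
  measurable_fun setT (fun t : n.-tuple T => tcons (x, t)).
Proof.
apply: measurableT_comp; first exact: measurable_tcons.
exact: measurable_fun_pair.
Qed.

Lemma bounded_measurable_tcons n (f : n.+1.-tuple T -> R) (x : T) :
  bounded_measurable f -> bounded_measurable (fun t => f (tcons (x, t))).
Proof.
move=> [mf [M fM]]; split; last by exists M.
by apply: measurableT_comp => //; exact: measurable_tcons_section.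
Qed.

Lemma power_prob_RintegralS n (f : n.+1.-tuple T -> R) :
  bounded_measurable f -> (forall x, 0 <= f x) ->
  let h x := \int[power_prob mu n]_t f (tcons (x, t)) in
  bounded_measurable h /\ \int[power_prob mu n.+1]_x f x = \int[mu]_x h x.
Proof.
move=> bf f0 h; have [mf [M fM]] := bf.
have mft : measurable_fun setT (fun z => (f (@tcons _ T n z))%:E).
  by apply/measurable_EFinP; exact: (measurableT_comp mf (@measurable_tcons _ T n)).
have hE x : (h x)%:E = (\int[power_prob mu n]_t (f (tcons (x, t)))%:E)%E.
  by rewrite integral_bounded//; exact: bounded_measurable_tcons.
have bh : bounded_measurable h.
  split.
    apply/measurable_EFinP; rewrite (_ : EFin \o h = fun x =>
      (\int[power_prob mu n]_t (f (tcons (x, t)))%:E)%E); last first.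
      by apply/funext => x /=; rewrite hE.
    apply: (measurable_fun_fubini_tonelli_F
      (fun z : T * n.-tuple T => (f (tcons z))%:E)) => //.
    by move=> z; rewrite lee_fin.
  exists M => x; rewrite ger0_norm; last exact: Rintegral_ge0.
  rewrite -(probability_Rintegral_cst (power_prob mu n) M).
  apply: bounded_le_Rintegral; [exact: bounded_measurable_tcons|
    exact: bounded_measurable_cst|].
  by move=> t; exact: le_trans (ler_norm _) (fM _).
split => //; apply: EFin_inj; rewrite -!integral_bounded//.
transitivity (\int[(mu \x power_prob mu n)%E]_z (f (tcons z))%:E)%E.
  by rewrite /= ge0_integral_distribution//; exact/measurable_EFinP.
rewrite fubini_tonelli1//; last by move=> z; rewrite lee_fin.
by apply: eq_integral => x _; rewrite hE.
Qed.

Lemma bounded_measurable_prod n (g : T -> R) : bounded_measurable g ->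
  bounded_measurable (fun x : n.-tuple T => \prod_(i < n) g (tnth x i)).
Proof.
move=> [mg [M gM]]; split.
  apply: measurable_prod => i _; apply: measurableT_comp => //.
  exact: measurable_tnth.
exists (\prod_(i < n) M) => x; rewrite normr_prod.
by apply: ler_prod => i _; rewrite normr_ge0 gM.
Qed.

Lemma power_prob_Rintegral_prod n (g : T -> R) :
  bounded_measurable g -> (forall x, 0 <= g x) ->
  \int[power_prob mu n]_x (\prod_(i < n) g (tnth x i)) = (\int[mu]_x g x) ^+ n.
Proof.
move=> bg g0; elim: n => [|n IH].
  under eq_Rintegral do rewrite big_ord0.
  by rewrite probability_Rintegral_cst.
have [_ ->] := power_prob_RintegralS (bounded_measurable_prod n.+1 bg)
  (fun x => prodr_ge0 _ (fun i _ => g0 (tnth x i))).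
transitivity (\int[mu]_x (g x * (\int[mu]_x g x) ^+ n)).
  apply: eq_Rintegral => x _; rewrite -IH.
  rewrite -bounded_RintegralZ; last exact: bounded_measurable_prod.
  apply: eq_Rintegral => t _; rewrite big_ord_recl; congr (_ * _).
  by apply: eq_bigr => i _; rewrite tnthS.
under eq_Rintegral do rewrite mulrC.
by rewrite bounded_RintegralZ// exprS mulrC.
Qed.

End power_integral.

Section tensorization.
Context {d : measure_display} {R : realType}.
Variable X : completeMetricMeasurableType d R.
Hypothesis X_borel : borel_measurable X.
Hypothesis X_separable : separable X.
Variable alpha : R -> R.
Hypothesis alpha_young : young_function alpha.
Variables (mu : probability X R) (c : R).
Hypothesis c_gt0 : 0 < c.

Let Qn n := infconv (@young_cost_tuple _ _ X alpha n).

Let c_ge0 : 0 <= c. Proof. exact: ltW. Qed.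

Lemma infconv_tcons_le n (f : n.+1.-tuple X -> R) (x y : X) (t : n.-tuple X) :
  (forall z, 0 <= f z) ->
  Qn f (tcons (x, t)) <=
    young_cost alpha x y + Qn (fun s => f (tcons (y, s))) t.
Proof.
move=> f0; rewrite -lerBlDl; apply: le_infconv => [u v|u|s].
- exact: young_cost_tuple_ge0.
- exact: f0.
rewrite lerBlDl.
apply: le_trans (infconv_le _ f0 _ (tcons (y, s))) _.
  exact: young_cost_tuple_ge0.
rewrite /young_cost_tuple big_ord_recl !tnth0 addrCA lerD2l lerD2l.
by apply: ler_sum => i _; rewrite !tnthS.
Qed.

(** Let h(y) be the mean of f(y, .). For fixed x and y, the induction hypothesis for f(y, .) bounds
    the mean over t of e^{c Qf(x, t)} by e^{c (alpha(d(x, y)) + h(y))}. The infimum over y turns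
    this exponent into c Qh(x), and the one-variable inequality for h finishes. *)
Lemma transport_inequality_exp_power n (f : n.-tuple X -> R) :
  transport_inequality alpha (1 / c) mu ->
  bounded_measurable f -> (forall x, 0 <= f x) ->
  \int[power_prob mu n]_x expR (c * Qn f x) <=
    expR (c * \int[power_prob mu n]_x f x).
Proof.
move=> Tmu; elim: n f => [|n IH] f bf f0.
  have -> : f = fun=> f [tuple].
    by apply/funext => x; rewrite tuple0.
  rewrite probability_Rintegral_cst.
  rewrite -[leRHS](probability_Rintegral_cst (power_prob mu 0)).
  apply: bounded_le_Rintegral.
  - apply/bounded_measurable_expR/bounded_measurableZ.
    apply: bounded_young_infconv_tuple => //; exact: bounded_measurable_cst.
  - exact: bounded_measurable_cst.
  - move=> x; rewrite ler_expR ler_wpM2l//; apply: infconv_le_fun => //.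
      exact: young_cost_tuple_ge0.
    exact: young_cost_tuple_diag.
have bQ : bounded_measurable (fun x => expR (c * Qn f x)).
  apply/bounded_measurable_expR/bounded_measurableZ.
  exact: bounded_young_infconv_tuple.
have [bG ->] := power_prob_RintegralS mu bQ (fun x => expR_ge0 _).
have [] := power_prob_RintegralS mu bf f0.
set h := fun x => _ => bh ->.
have h0 x : 0 <= h x by exact: Rintegral_ge0.
apply: le_trans (transport_inequality_exp X_borel X_separable alpha_young c_gt0
  Tmu bh h0).
apply: bounded_le_Rintegral => //.
  apply/bounded_measurable_expR/bounded_measurableZ.
  exact: bounded_young_infconv.
move=> x; set G := (leLHS).
have bQx : bounded_measurable (fun t => c * Qn f (tcons (x, t))).
  apply: bounded_measurableZ; apply: bounded_measurable_tcons.
  exact: bounded_young_infconv_tuple.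
have G0 : 0 < G by exact: Rintegral_expR_gt0.
rewrite -ler_ln ?posrE ?expR_gt0// expRK -ler_pdivrMl//.
apply: le_infconv => [u v|//|y]; first exact: young_cost_ge0.
rewrite ler_pdivrMl// -[leRHS]expRK ler_ln ?posrE ?expR_gt0//.
have bfy := bounded_measurable_tcons y bf.
have fy0 s : 0 <= f (tcons (y, s)) by exact: f0.
rewrite mulrDr addrC expRD.
apply: le_trans (ler_wpM2l (expR_ge0 _) (IH _ bfy fy0)).
have bQy : bounded_measurable (fun t => expR (c * Qn (fun s => f (tcons (y, s))) t)).
  apply/bounded_measurable_expR/bounded_measurableZ.
  exact: bounded_young_infconv_tuple.
rewrite -bounded_RintegralZ//; apply: bounded_le_Rintegral.
- exact: bounded_measurable_expR.
- exact: bounded_measurableZ.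
- move=> t; rewrite -expRD ler_expR -mulrDr ler_wpM2l//.
  exact: infconv_tcons_le.
Qed.

End tensorization.

(** * From concentration to the transport inequality *)

Section tuple_topology.
Context {d : measure_display} {R : realType}.
Variable X : completeMetricMeasurableType d R.

(** Product-open sets must be shown open for coordinatewise balls: a failure at every radius 1 / (k
    + 1) would give a sequence converging to x in the product topology, against continuity. *)
Lemma measurable_tuple_continuous n (f : n.-tuple X -> R) :
  borel_measurable X -> separable X -> tuple_continuous f ->
  measurable_fun setT f.
Proof.
move=> X_borel X_separable cf; apply: measurable_fun_sublevel => s.
apply: (measurable_tuple_open X_borel X_separable) => x /= fxs.
apply: contrapT => noe.
have /choice[y yP] : forall k : nat, exists y : n.-tuple X,
    (forall i, mdist (tnth x i) (tnth y i) < k.+1%:R^-1 :> R) /\ s <= f y.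
  move=> k; apply: contrapT => noy; apply: noe; exists k.+1%:R^-1 => // y xy.
  by rewrite ltNge; apply/negP => sfy; apply: noy; exists y.
pose u k : {ptws 'I_n -> X} := tnth (y k).
have tnthK (z : n.-tuple X) : [tuple tnth z i | i < n] = z.
  by apply: eq_from_tnth => i; rewrite tnth_mktuple.
have ux : u @ \oo --> (tnth x : {ptws 'I_n -> X}).
  apply/cvg_sup => i; rewrite cvg_image; last first.
    by rewrite eqEsubset; split=> v // _; exists (fun=> v).
  have uxi : u k i @[k --> \oo] --> tnth x i; last first.
    move=> W /uxi Wk; exists ((fun v : {ptws 'I_n -> X} => v i) @^-1` W) => //.
    by rewrite eqEsubset; split => [j [v + <-]//|j Wj]; exists (fun=> j).
  apply/cvg_ballP => e e0; near=> k; rewrite ballEmdist /=; apply: lt_le_trans ((yP k).1 i) _.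
  near: k; exists (Num.truncn e^-1) => // k /= ek.
  rewrite invf_ple ?posrE//; apply/ltW/(lt_le_trans (truncnS_gt _)).
  by rewrite ler_nat ltnS.
have := cvg_comp _ _ ux (cf (tnth x)).
rewrite tnthK => /cvgr_lt/(_ s fxs)[k _ /(_ k (leqnn k))]/=.
by rewrite tnthK ltNge (yP k).2.
Unshelve. all: by end_near. Qed.

Lemma tuple_continuous_sum_max n (phi : X -> R) (m : R) : continuous phi ->
  tuple_continuous (fun x : n.-tuple X =>
    Num.max 0 (\sum_(i < n) (phi (tnth x i) - m))).
Proof.
move=> cphi x; apply: (@continuous_max R _ (fun=> 0) _ x); first exact: cst_continuous.
move: (index_enum _) => r.
elim: r => [|i r IH].
  rewrite (_ : (fun _ => _) = fun=> 0); first exact: cst_continuous.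
  by apply/funext => y; rewrite big_nil.
rewrite (_ : (fun _ => _) = fun y : {ptws 'I_n -> X} => (phi (y i) - m) +
    \sum_(j <- r) (phi (tnth [tuple y i | i < n] j) - m)); last first.
  by apply/funext => y; rewrite big_cons tnth_mktuple.
apply: (@continuousD R R^o) => //.
apply: (@continuousB R R^o); last exact: cst_continuous.
apply: (@continuous_comp _ _ _ (fun y : {ptws 'I_n -> X} => y i)).
  exact: (@proj_continuous _ (fun=> X) i).
exact: cphi.
Qed.

End tuple_topology.

(** From e^{-u} >= 1 - u comes e^u <= 1 / (1 - u), and (1 - u)(1 + u + 2 u^2) = 1 + u^2 (1 - 2 u) is
    at least 1 for u <= 1/2. *)
Lemma expR_le_quadratic (R : realType) (u : R) : `|u| <= 1 / 2 ->
  expR u <= 1 + u + 2 * u ^+ 2.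
Proof.
rewrite ler_norml => /andP[u1 u2].
have v0 : 0 < 1 - u by lra.
apply: (@le_trans _ _ (1 - u)^-1).
  rewrite -[expR u]invrK -expRN lef_pV2 ?posrE ?expR_gt0//.
  by have := expR_ge1Dx (- u); lra.
rewrite -[leLHS]mul1r ler_pdivrMr//.
have := sqr_ge0 u; nra.
Qed.

Lemma le1_of_bounded_powers (R : realType) (r A : R) :
  (forall n, (1 <= n)%N -> r ^+ n <= A) -> r <= 1.
Proof.
move=> rA; rewrite leNgt; apply/negP => r1.
have bern n : 1 + n%:R * (r - 1) <= r ^+ n.
  elim: n => [|n IH]; first by rewrite expr0 mul0r addr0.
  rewrite exprS -natr1; have n0 : 0 <= n%:R :> R by [].
  have r0 : 0 <= r by lra.
  apply: le_trans (ler_wpM2l r0 IH).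
  by move: (n%:R : R) n0 => k k0; have := sqr_ge0 (r - 1); nra.
pose n := (Num.truncn (A / (r - 1))).+1.
have : A / (r - 1) < n%:R by exact: truncnS_gt.
rewrite ltr_pdivrMr ?subr_gt0// => An.
have := rA n isT; have := bern n; lra.
Qed.

(* [1 + lambda x + 2 (lambda x)^2] integrates to at most 1 for small lambda when
   x has negative mean. *)
Lemma exists_exponential_moment_le1 {d} {T : measurableType d} {R : realType}
    (mu : probability T R) (f : T -> R) :
  bounded_measurable f -> \int[mu]_x f x < 0 ->
  exists2 lambda : R, 0 < lambda & \int[mu]_x expR (lambda * f x) <= 1.
Proof.
move=> bf f0; have [mf [M0 fM0]] := bf.
pose M := Num.max 1 M0.
have M1 : 1 <= M by rewrite le_max lexx.
have fM x : `|f x| <= M by rewrite (le_trans (fM0 x))// le_max lexx orbT.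
set e := - \int[mu]_x f x; have e0 : 0 < e by rewrite oppr_gt0.
have M0' : 0 < M by lra.
(* The first bound makes [lambda * f x] at most 1/2 in absolute value; the second makes the
   quadratic term at most [lambda * e], exactly what the negative mean gains. *)
pose lambda := Num.min (1 / (2 * M)) (e / (2 * M ^+ 2)).
have l0 : 0 < lambda by rewrite lt_min !divr_gt0// ?mulr_gt0// exprn_gt0.
have lM : lambda * M <= 1 / 2.
  have : lambda <= 1 / (2 * M) by rewrite ge_min lexx.
  by rewrite ler_pdivlMr ?mulr_gt0//; lra.
have le : lambda * (2 * M ^+ 2) <= e.
  by rewrite -ler_pdivlMr ?mulr_gt0 ?exprn_gt0// ge_min lexx orbT.
exists lambda => //.
apply: (@le_trans _ _ (\int[mu]_x (lambda * f x + (1 + lambda * e)))).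
  apply: bounded_le_Rintegral.
  - exact/bounded_measurable_expR/bounded_measurableZ.
  - apply: bounded_measurableD; first exact: bounded_measurableZ.
    exact: bounded_measurable_cst.
  - move=> x; have lf : `|lambda * f x| <= lambda * M.
      by rewrite normrM gtr0_norm// ler_pM2l.
    apply: (le_trans (expR_le_quadratic (le_trans lf lM))).
    have : (lambda * f x) ^+ 2 <= (lambda * M) ^+ 2.
      by rewrite -real_normK ?num_real// ler_sqr ?nnegrE// mulr_ge0 ?ltW.
    have := ler_wpM2l (ltW l0) le.
    by rewrite [(lambda * M) ^+ 2]exprMn expr2; lra.
rewrite bounded_RintegralD ?bounded_RintegralZ//; first last.
- exact: bounded_measurable_cst.
- exact: bounded_measurableZ.
rewrite probability_Rintegral_cst -[\int[mu]_x f x]opprK -/e.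
by rewrite mulrN addrCA addNr addr0.
Qed.

Lemma le_expR_addgt0 (R : realType) (x y : R) : 0 < x ->
  (forall e, 0 < e -> x <= expR (y + e)) -> x <= expR y.
Proof.
move=> x0 h; rewrite -ler_ln ?posrE ?expR_gt0// expRK.
apply/ler_addgt0Pr => e /h.
by rewrite -ler_ln ?posrE ?expR_gt0// expRK.
Qed.

Section dimension_free.
Context {d : measure_display} {R : realType}.
Variable X : completeMetricMeasurableType d R.
Hypothesis X_borel : borel_measurable X.
Hypothesis X_separable : separable X.
Variables (mu : probability X R) (alpha : R -> R) (c : R).
Hypothesis alpha_young : young_function alpha.
Hypothesis c_gt0 : 0 < c.

Let Q := infconv (young_cost alpha : X -> X -> R).
Let Qn n := infconv (@young_cost_tuple _ _ X alpha n).

Let c_ge0 : 0 <= c. Proof. exact: ltW. Qed.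

Lemma sum_infconv_le n (phi : X -> R) (f : n.-tuple X -> R) (m : R) x :
  (forall y, 0 <= phi y) -> (forall y, 0 <= f y) ->
  (forall y, \sum_(i < n) (phi (tnth y i) - m) <= f y) ->
  \sum_(i < n) (Q phi (tnth x i) - m) <= Qn f x.
Proof.
move=> phi0 f0 phif; apply: le_infconv => [u v|//|y].
  exact: young_cost_tuple_ge0.
apply: le_trans (lerD (phif y) (lexx _)); rewrite -big_split/=.
apply: ler_sum => i _; rewrite addrAC lerD2r.
by apply: infconv_le => //; exact: young_cost_ge0.
Qed.

Variables a b : R.
Hypothesis a_gt0 : 0 < a.
Hypothesis b_gt0 : 0 < b.
Hypothesis concentration : forall (n : nat) (f : n.-tuple X -> R),
  (1 <= n)%N -> tuple_continuous f -> (exists M : R, forall x, f x <= M) ->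
  (forall x, 0 <= f x) ->
  (\int[power_prob mu n]_x (expR (c * inf_convolution alpha f x))%:E
     <= (a * expR (b * \int[power_prob mu n]_x f x))%:E)%E.

(* Apply the hypothesis to the positive part of [\sum_i (phi (x i) - m)] with [m]
   slightly above the mean of [phi]: its expectation stays bounded in [n], so
   that the constants [a] and [b] disappear in the n-th root. *)
Lemma exp_infconv_continuous (phi : X -> R) :
  continuous phi -> bounded_measurable phi -> (forall x, 0 <= phi x) ->
  \int[mu]_x expR (c * Q phi x) <= expR (c * \int[mu]_x phi x).
Proof.
move=> cphi bphi phi0; have [_ [B phiB]] := bphi.
have bQ : bounded_measurable (Q phi) by exact: bounded_young_infconv.
have bcQ := bounded_measurableZ c bQ.
apply: le_expR_addgt0; first exact: Rintegral_expR_gt0.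
(* With e divided by c, the loss in the final exponent is exactly e. *)
move=> e e0; pose m := \int[mu]_x phi x + e / c.
have bm : bounded_measurable (fun x => phi x + (- m)).
  by apply: bounded_measurableD => //; exact: bounded_measurable_cst.
have [lam lam0 lam1] : exists2 lam : R, 0 < lam &
    \int[mu]_x expR (lam * (phi x - m)) <= 1.
  apply: exists_exponential_moment_le1 => //.
  rewrite bounded_RintegralD//; last exact: bounded_measurable_cst.
  by rewrite probability_Rintegral_cst /m opprD addrA subrr add0r oppr_lt0 divr_gt0.
have blam : bounded_measurable (fun x => expR (lam * (phi x - m))).
  exact/bounded_measurable_expR/bounded_measurableZ.
pose r := \int[mu]_x expR (c * (Q phi x - m)).
have rE : r = expR (- (c * m)) * \int[mu]_x expR (c * Q phi x).
  rewrite -bounded_RintegralZ; last exact: bounded_measurable_expR.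
  by apply: eq_Rintegral => x _; rewrite -expRD mulrBr addrC.
have bQm : bounded_measurable (fun x => expR (c * (Q phi x - m))).
  apply/bounded_measurable_expR/bounded_measurableZ.
  by apply: bounded_measurableD => //; exact: bounded_measurable_cst.
suff : r <= 1.
  rewrite rE expRN mulrC ler_pdivrMr ?expR_gt0// mul1r.
  by rewrite /m mulrDr mulrCA divff ?mulr1// gt_eqF.
apply: (@le1_of_bounded_powers _ _ (a * expR (b * lam^-1))) => n n1.
pose f (x : n.-tuple X) := Num.max 0 (\sum_(i < n) (phi (tnth x i) - m)).
have f0 x : 0 <= f x by rewrite le_max lexx.
have cf : tuple_continuous f by exact: tuple_continuous_sum_max.
pose C : R := \sum_(i < n) (B + `|m|).
have fB x : f x <= C.
  rewrite ge_max; apply/andP; split.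
    apply: sumr_ge0 => i _; rewrite addr_ge0//.
    exact: le_trans (normr_ge0 _) (phiB (tnth x i)).
  apply: ler_sum => i _; apply: lerD.
    exact: le_trans (ler_norm _) (phiB _).
  by rewrite -normrN; exact: ler_norm.
have bf : bounded_measurable f.
  split; first exact: measurable_tuple_continuous.
  by exists C => x; rewrite ger0_norm; [exact: fB|exact: f0].
have := concentration n1 cf (ex_intro _ _ fB) f0.
rewrite (_ : inf_convolution alpha f = Qn f)//.
have bQf : bounded_measurable (Qn f) by exact: bounded_young_infconv_tuple.
have bcQf := bounded_measurableZ c bQf.
rewrite integral_bounded; last exact: bounded_measurable_expR.
rewrite lee_fin => conc.
(* The positive part of s is at most [lam^-1 * expR (lam * s)], and by independence the exponential
   of the sum has mean at most 1; hence a bound free of n. *)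
have fexp : \int[power_prob mu n]_x f x <= lam^-1.
  apply: (@le_trans _ _ (\int[power_prob mu n]_x
      (lam^-1 * \prod_(i < n) expR (lam * (phi (tnth x i) - m))))).
    apply: bounded_le_Rintegral => //.
      exact/bounded_measurableZ/(bounded_measurable_prod n blam).
    move=> x; rewrite -expR_sum -mulr_sumr ler_pdivlMl// /f.
    move: (\sum_(i < n) _) => s; rewrite maxr_pMr ?(ltW lam0)// mulr0.
    rewrite ge_max expR_ge0/=.
    by apply: le_trans (expR_ge1Dx _); rewrite lerDr.
  rewrite bounded_RintegralZ; last exact: (bounded_measurable_prod n blam).
  rewrite (power_prob_Rintegral_prod mu n blam (fun x => expR_ge0 _)).
  rewrite ler_piMr ?invr_ge0 ?(ltW lam0)// exprn_ile1//.
  by apply: Rintegral_ge0 => x _; exact: expR_ge0.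
apply: (@le_trans _ _ (a * expR (b * \int[power_prob mu n]_x f x))); last first.
  by rewrite ler_pM2l// ler_expR ler_pM2l.
apply: le_trans conc.
rewrite -(power_prob_Rintegral_prod mu n bQm (fun x => expR_ge0 _)).
apply: bounded_le_Rintegral; [exact: (bounded_measurable_prod n bQm)|
  exact: bounded_measurable_expR|].
move=> x; rewrite -expR_sum -mulr_sumr ler_expR ler_wpM2l//.
by apply: sum_infconv_le => // y; rewrite le_max lexx orbT.
Qed.

Let lipschitz_infconv (k : R) := infconv (fun x y : X => k * mdist x y).

Lemma continuous_lipschitz_infconv (k : R) (phi : X -> R) : 0 < k ->
  (forall x, 0 <= phi x) -> continuous (lipschitz_infconv k phi).
Proof.
move=> k0 phi0 x; have cost0 (u v : X) : 0 <= k * mdist u v.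
  by rewrite mulr_ge0 ?mdist_ge0// ltW.
have lip u v : lipschitz_infconv k phi u <= lipschitz_infconv k phi v + k * mdist u v.
  rewrite -lerBlDr; apply: le_infconv => // y; rewrite lerBlDr.
  apply: le_trans (infconv_le cost0 phi0 u y) _.
  rewrite -addrA lerD2l -mulrDr ler_pM2l// addrC; exact: metric_triangle.
apply/cvgrPdist_lt => e e0.
apply/nbhs_ballP; exists (e / k) => /=; first by rewrite divr_gt0.
move=> y; rewrite ballEmdist/= ltr_pdivlMr// mulrC => xy.
have := lip x y; have := lip y x; rewrite (metric_sym y x) ltr_norml.
by move=> h1 h2; apply/andP; split; lra.
Qed.

(** A y violating the claim at x has alpha(d(x, y)) <= M, and a near-minimizer z for the regularized
    value at y lies within [delta] of y. By the modulus, replacing y by z raises the transport cost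
    by at most e, uniformly in x. *)
Lemma infconv_lipschitz_approx (phi : X -> R) (M e : R) :
  (forall x, 0 <= phi x) -> (forall x, phi x <= M) -> 0 < e ->
  exists2 k : R, 0 < k & forall x, Q phi x <= Q (lipschitz_infconv k phi) x + e.
Proof.
move=> phi0 phiM e0.
have [delta delta0 modulus] := young_modulus alpha_young M e0.
have M0 : 0 <= M by exact: le_trans (phi0 point) (phiM point).
(* Moving farther than [delta] costs more than M + 1, beyond any value of [phi]; the added 1 keeps k
   positive when M = 0. *)
pose k := (M + 1) / delta.
have k0 : 0 < k by rewrite divr_gt0//; lra.
exists k => // x; have cost0 (u v : X) : 0 <= k * mdist u v.
  by rewrite mulr_ge0 ?mdist_ge0// ltW.
have phik0 y : 0 <= lipschitz_infconv k phi y by exact: infconv_ge0.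
rewrite -lerBlDr; apply: le_infconv => // [u v|y]; first exact: young_cost_ge0.
rewrite lerBlDr leNgt; apply/negP => lt_phik.
have QM : Q phi x <= M.
  apply: le_trans (phiM x); apply: infconv_le_fun => //.
    exact: young_cost_ge0.
  exact: young_cost_diag.
have lt_r : lipschitz_infconv k phi y < Q phi x - e - young_cost alpha x y by lra.
have [z zlt] := infconv_lt cost0 phi0 lt_r.
have cost_xy := young_cost_ge0 alpha_young x y.
have yz : mdist y z <= delta.
  have : k * mdist y z <= M + 1 by have := phi0 z; lra.
  by rewrite mulrAC ler_pdivrMr// ler_pM2l//; lra.
have alphaM : alpha (mdist x y) <= M.
  have := phik0 y; move: lt_r; rewrite /young_cost; lra.
have := modulus _ (mdist x z) (mdist_ge0 x y) (mdist_ge0 x z) alphaM.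
have -> : mdist x z <= mdist x y + delta.
  by have := metric_triangle x y z; lra.
move=> /(_ isT) alpha_xz.
have : Q phi x <= phi z + young_cost alpha x z.
  by apply: infconv_le => //; exact: young_cost_ge0.
have := cost0 y z; move: zlt; rewrite /young_cost; lra.
Qed.

Lemma exp_infconv_measurable (phi : X -> R) :
  bounded_measurable phi -> (forall x, 0 <= phi x) ->
  \int[mu]_x expR (c * Q phi x) <= expR (c * \int[mu]_x phi x).
Proof.
move=> bphi phi0; have [_ [M phiM]] := bphi.
have bQ : bounded_measurable (Q phi) by exact: bounded_young_infconv.
have bcQ := bounded_measurableZ c bQ.
apply: le_expR_addgt0; first exact: Rintegral_expR_gt0.
move=> e e0; have ec0 : 0 < e / c by rewrite divr_gt0.
have [k k0 Q_le] := infconv_lipschitz_approx phi0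
  (fun x => le_trans (ler_norm _) (phiM x)) ec0.
have cost0 (u v : X) : 0 <= k * mdist u v.
  by rewrite mulr_ge0 ?mdist_ge0// ltW.
pose phik := lipschitz_infconv k phi.
have phik0 x : 0 <= phik x by exact: infconv_ge0.
have phik_le x : phik x <= phi x.
  by apply: infconv_le_fun => // y; rewrite mdistxx mulr0.
have cphik : continuous phik by exact: continuous_lipschitz_infconv.
have bphik : bounded_measurable phik.
  split.
    apply: measurable_fun_sublevel => s; apply: open_borel => //.
    rewrite (_ : [set x | phik x < s] = phik @^-1` [set t | t < s])//.
    by apply: open_comp => [x _|]; [exact: cphik|exact: open_lt].
  exists M => x; rewrite ger0_norm//.
  exact: le_trans (phik_le x) (le_trans (ler_norm _) (phiM x)).
have bQk : bounded_measurable (Q phik) by exact: bounded_young_infconv.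
have bcQk := bounded_measurableZ c bQk.
rewrite addrC expRD.
apply: (@le_trans _ _ (expR e * expR (c * \int[mu]_x phik x))); last first.
  rewrite ler_pM2l ?expR_gt0// ler_expR ler_wpM2l//.
  exact: bounded_le_Rintegral.
apply: le_trans (ler_wpM2l (expR_ge0 e) (exp_infconv_continuous cphik bphik phik0)).
rewrite -bounded_RintegralZ; last exact: bounded_measurable_expR.
apply: bounded_le_Rintegral; [exact: bounded_measurable_expR|
  exact/bounded_measurableZ/bounded_measurable_expR|].
move=> x; rewrite -expRD ler_expR.
have := ler_wpM2l c_ge0 (Q_le x).
by rewrite mulrDr mulrCA divff ?gt_eqF// mulr1 addrC.
Qed.

Hypothesis X_proper : compact_closed_balls X.

Lemma concentration_transport_inequality : transport_inequality alpha (1 / c) mu.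
Proof.
move=> nu.
have entropy_ge0 : (0 <= relative_entropy nu mu)%E.
  have b0 := @bounded_measurable_cst _ X _ (0 : R).
  have := gibbs_inequality mu nu b0.
  by rewrite !probability_Rintegral_cst expR0 ln1 subr0.
case entropyE : (relative_entropy nu mu) entropy_ge0 => [H| |//] _; last first.
  by rewrite gt0_muley ?leey// lte_fin divr_gt0.
have [pi cpi] : exists2 pi, coupling nu mu pi &
    (\int[pi]_z (alpha (mdist z.1 z.2))%:E <= (1 / c * H)%:E)%E.
  apply: kantorovich_duality => //.
  - by move=> z; exact: young_ge0.
  - exact: young_mdist_open.
  move=> psi phi bpsi bphi dual; have [_ [M phiM]] := bphi.
  have bM := @bounded_measurable_cst _ X _ M.
  (* The exponential inequality concerns nonnegative functions; adding M to both [psi] and [phi]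
     preserves the dual constraint and cancels at the end. *)
  have bphiM := bounded_measurableD bphi bM.
  have phiM0 x : 0 <= phi x + M.
    by have := phiM x; rewrite ler_norml => /andP[]; lra.
  have bQ : bounded_measurable (Q (fun x => phi x + M)).
    exact: bounded_young_infconv.
  have bcQ := bounded_measurableZ c bQ.
  have psiQ : \int[nu]_x psi x + M <= \int[nu]_x Q (fun x => phi x + M) x.
    rewrite -[in leLHS](probability_Rintegral_cst nu M) -bounded_RintegralD//.
    apply: bounded_le_Rintegral => //; first exact: bounded_measurableD.
    move=> x; apply: le_infconv => // [u v|y]; first exact: young_cost_ge0.
    by have := dual x y; rewrite /young_cost/=; lra.
  have := exp_infconv_measurable bphiM phiM0.
  rewrite -ler_ln ?posrE ?expR_gt0//; last exact: Rintegral_expR_gt0.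
  rewrite expRK bounded_RintegralD// probability_Rintegral_cst => exp_le.
  have := gibbs_inequality mu nu bcQ.
  rewrite entropyE lee_fin bounded_RintegralZ// => gibbs.
  have : c * (\int[nu]_x psi x + M) <= c * (\int[mu]_x phi x + M) + H.
    apply: le_trans (ler_wpM2l c_ge0 psiQ) _.
    by rewrite -lerBlDl (le_trans (lerB (lexx _) exp_le)).
  have cH : c * (1 / c * H) = H by rewrite mul1r mulrA mulfV ?gt_eqF// mul1r.
  move=> h; rewrite -(ler_pM2l c_gt0) mulrDr cH.
  by move: h; rewrite !mulrDr [leRHS]addrAC lerD2r.
move=> pile; rewrite -EFinM; apply: le_trans pile; apply: ereal_inf_lbound.
by exists pi.
Qed.

End dimension_free.

Theorem proposition2p3 (d : measure_display) (R : realType)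
    (X : completeMetricMeasurableType d R)
    (X_borel : borel_measurable X)
    (X_separable : separable X)
    (X_proper : compact_closed_balls X)
    (mu : probability X R) (alpha : R -> R) (c : R)
    (alpha_young : young_function alpha) (c_gt0 : 0 < c) :
  transport_inequality alpha (1 / c) mu
  <->
  exists a b : R, [/\ 0 < a, 0 < b &
    forall (n : nat) (f : n.-tuple X -> R),
      (1 <= n)%N ->
      tuple_continuous f ->
      (exists M : R, forall x, f x <= M) ->
      (forall x, 0 <= f x) ->
      (\int[power_prob mu n]_x (expR (c * inf_convolution alpha f x))%:E
       <= (a * expR (b * \int[power_prob mu n]_x f x))%:E)%E].
Proof.
split=> [Tmu|[a [b [a_gt0 b_gt0 conc]]]]; last first.
  exact: (concentration_transport_inequality X_borel X_separable alpha_young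
    c_gt0 a_gt0 b_gt0 conc X_proper).
exists 1, c; split => // n f _ cf [M fM] f0; rewrite mul1r.
have bf : bounded_measurable f.
  split; first exact: measurable_tuple_continuous.
  by exists M => x; rewrite ger0_norm.
have bQ := bounded_young_infconv_tuple X_borel X_separable alpha_young f0 bf.
have beQ := bounded_measurable_expR (bounded_measurableZ c bQ).
rewrite (_ : inf_convolution alpha f = infconv (young_cost_tuple alpha (n:=n)) f)//.
rewrite integral_bounded// lee_fin.
exact: (transport_inequality_exp_power X_borel X_separable alpha_young c_gt0).
Qed.
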